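(* The optimal diversity-multiplexing gain tradeoff of the $n\times1$ two-product channel is given by $$d_{\text{eq}}(r_\chi)=n(1-r_\chi),\qquad 0\le r_\chi\le1.$$
   Context: $f\doteq \mathrm{SNR}^{b}$ means $\lim_{\mathrm{SNR}\to\infty}\log f/\log \mathrm{SNR}=b$. $\mathbb{C}\mathcal{N}(0,\mathrm{SNR}^0)$ denotes a zero-mean circularly symmetric complex Gaussian with variance $\doteq\mathrm{SNR}^0$. The $n\times1$ two-product channel is the MISO channel (with $n$ transmit antennas and one receive antenna) $\underline y=\theta HX+W$, with $X$ an $n\times T$ code matrix, $\theta$ a scalar meeting the power constraint $\mathbb{E}\|\theta X\|_F^2\doteq\mathrm{SNR}$, and $H=[g_1h_1\ \ g_2h_2\ \cdots\ g_nh_n]$, where $g_1,\dots,g_n,h_1,\dots,h_n$ are i.i.d. $\mathbb{C}\mathcal{N}(0,\mathrm{SNR}^0)$ random variables. $H$ is constant over the code duration and known to the receiver only; the noise $W$ consists of spatially and temporally white $\mathbb{C}\mathcal{N}(0,1)$ random variables. A code of rate $R_\chi$ bits per channel use has multiplexing gain $r_\chi=R_\chi/\log_2\mathrm{SNR}$ and diversity gain $d(r_\chi)=-\lim_{\mathrm{SNR}\to\infty}\log P_e/\log\mathrm{SNR}$, with $P_e$ the codeword error probability. The optimal tradeoff is the largest $d(r_\chi)$ attainable at each $r_\chi$. *)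

(* Defs.v *)
(* MathComp-Analysis, with the complex numbers R[i] of mathcomp-real-closed. *)
From HB Require Import structures.
From mathcomp Require Export all_boot all_order all_algebra.
From mathcomp Require Export complex.
From mathcomp Require Export all_classical all_reals all_analysis.

Set Implicit Arguments.
Unset Strict Implicit.
Unset Printing Implicit Defensive.

Export Order.TTheory GRing.Theory Num.Theory.
Export numFieldNormedType.Exports.

Local Open Scope classical_set_scope.
Local Open Scope ring_scope.

Section Asymptotics.
Context {R : realType}.

(* [doteq f b] is f =. SNR^b. As [lne] is the extended logarithm (lne 0 = -oo),
   an identically zero f has exponent -oo. *)
Definition doteq (f : R -> R) (b : \bar R) : Prop :=
  (lne (f snr)%:E / (ln snr)%:E)%E @[snr --> +oo] --> b.

Definition log2 (x : R) : R := ln x / ln 2.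

End Asymptotics.

Section ComplexRandomVariables.
Context {R : realType} {d : measure_display} {Omega : measurableType d}.
Context (P : probability Omega R).

Definition complex_borel : set (set R[i]) :=
  <<s [set A | exists B : set R, measurable B /\
        (A = (@complex.Re R) @^-1` B \/ A = (@complex.Im R) @^-1` B)] >>.

(* Product sigma-algebra on a space V with complex coordinates [coord k]. *)
Definition coordinate_borel (V K : Type) (coord : K -> V -> R[i]) :
    set (set V) :=
  <<s [set A | exists k (B : set R[i]),
        complex_borel B /\ A = coord k @^-1` B] >>.

(* CN(0, v): the real and imaginary parts are independent N(0, v/2).  The second
   argument of [normal_prob] is the standard deviation. *)
Definition is_CN (v : R) (Z : Omega -> R[i]) : Prop :=
  (forall A, complex_borel A -> measurable (Z @^-1` A)) /\
  (forall A B : set R, measurable A -> measurable B ->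
    P (Z @^-1` [set z | A (complex.Re z) /\ B (complex.Im z)]) =
    (normal_prob 0 (Num.sqrt (v / 2)) A *
     normal_prob 0 (Num.sqrt (v / 2)) B)%E).

Definition mutually_independent (I : eqType) (Z : I -> Omega -> R[i]) : Prop :=
  forall (s : seq I) (A : I -> set R[i]), uniq s ->
    (forall k, complex_borel (A k)) ->
    P (\bigcap_(k in [set` s]) (Z k @^-1` A k)) =
    (\big[*%E/1]_(k <- s) P (Z k @^-1` A k))%E.

End ComplexRandomVariables.

Section Channel.
Context {R : realType} {d : measure_display} {Omega : measurableType d}.
Context (P : probability Omega R) (n : nat).

(* The randomness of the channel at one value of the SNR: [noise t] is the
   additive noise at the receive antenna in channel use t, so a code of
   duration T meets noise 0, ..., noise T.-1. *)
Record channel := Channel {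
  gain_g : 'I_n -> Omega -> R[i] ;
  gain_h : 'I_n -> Omega -> R[i] ;
  noise  : nat -> Omega -> R[i] }.

Definition channel_rv (ch : channel) (k : 'I_n + 'I_n + nat) :
    Omega -> R[i] :=
  match k with
  | inl (inl i) => gain_g ch i
  | inl (inr i) => gain_h ch i
  | inr t => noise ch t
  end.

(* The common variance [v snr] of the 2n fading coefficients may vary with the
   SNR, as long as it is =. SNR^0. *)
Definition two_product_channel (v : R -> R) (ch : R -> channel) : Prop :=
  [/\ doteq v 0%E,
      (forall snr, 0 < snr -> 0 < v snr) &
      forall snr, 0 < snr ->
        [/\ forall i, is_CN P (v snr) (gain_g (ch snr) i),
            forall i, is_CN P (v snr) (gain_h (ch snr) i),
            forall t, is_CN P 1 (noise (ch snr) t) &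
            mutually_independent P (channel_rv (ch snr))]].

Definition channel_vector (ch : channel) (w : Omega) : 'rV[R[i]]_n :=
  \row_i (gain_g ch i w * gain_h ch i w).

Definition noise_vector (ch : channel) (T : nat) (w : Omega) : 'rV[R[i]]_T :=
  \row_(t < T) noise ch t w.

(* The receiver knows H but not g and h separately, and the transmitter knows
   neither, so [decode] takes H as an argument and [codeword] does not. *)
Record code (T : nat) := Code {
  ncodewords : nat ;
  codeword : 'I_ncodewords -> 'M[R[i]]_(n, T) ;
  theta : R[i] ;
  decode : 'rV[R[i]]_n -> 'rV[R[i]]_T -> 'I_ncodewords }.

Definition coordinate (T : nat) (k : 'I_n + 'I_T)
    (z : 'rV[R[i]]_n * 'rV[R[i]]_T) : R[i] :=
  match k with inl i => z.1 0 i | inr t => z.2 0 t end.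

(* With a single codeword there is nothing to decode: the error probability
   would vanish and every diversity gain would be exceeded at rate 0. *)
Definition valid_code (T : nat) (c : code T) : Prop :=
  [/\ (1 < ncodewords c)%N,
      injective (@codeword T c) &
      forall m, coordinate_borel (@coordinate T)
        [set z | decode c z.1 z.2 = m]].

Definition received (T : nat) (ch : channel) (c : code T)
    (m : 'I_(ncodewords c)) (w : Omega) : 'rV[R[i]]_T :=
  theta c *: (channel_vector ch w *m codeword m) + noise_vector ch T w.

Definition frobenius_sq (p q : nat) (A : 'M[R[i]]_(p, q)) : R :=
  \sum_i \sum_j ComplexField.Normc.normc (A i j) ^+ 2.

Definition average_power (T : nat) (c : code T) : R :=
  (ncodewords c)%:R^-1 *
  \sum_(m < ncodewords c) frobenius_sq (theta c *: codeword m).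

Definition error_probability (T : nat) (ch : channel) (c : code T) : R :=
  (ncodewords c)%:R^-1 *
  \sum_(m < ncodewords c)
    fine (P [set w | decode c (channel_vector ch w) (received ch m w) <> m]).

Definition rate (T : nat) (c : code T) : R :=
  log2 (ncodewords c)%:R / T%:R.

Definition multiplexing_gain (T : nat) (C : R -> code T) (r : R) : Prop :=
  rate (C snr) / log2 snr @[snr --> +oo] --> r.

Definition diversity_gain (ch : R -> channel) (T : nat) (C : R -> code T)
    (delta : \bar R) : Prop :=
  doteq (fun snr => error_probability (ch snr) (C snr)) (- delta)%E.

(* The duration T is a free parameter of the code, fixed as the SNR grows. *)
Definition attainable (ch : R -> channel) (r : R) (delta : \bar R) : Prop :=
  exists (T : nat) (C : R -> code T),
    [/\ (0 < T)%N,
        forall snr, 0 < snr -> valid_code (C snr),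
        doteq (fun snr => average_power (C snr)) 1%E,
        multiplexing_gain C r &
        diversity_gain ch C delta].

Definition optimal_tradeoff (ch : R -> channel) (r : R) (delta : \bar R) :
    Prop :=
  attainable ch r delta /\
  forall delta', attainable ch r delta' -> (delta' <= delta)%E.

End Channel.

(* Main.v *)
(** Converse: on the event that every [|g_i|] is at most [snr^(-(1-r)/2-eps)] and every
    [|h_i|] is of order one, which has probability at least [snr^(-n(1-r)-2n eps)] up to
    a constant, every received codeword of moderate power has norm at most
    [snr^((r-2eps)/2)] up to smaller powers.  Replacing the unit variance noise by noise
    of variance [1 + snr^(r-eps)] then costs a factor close to [(1 + snr^(r-eps))^T] in
    probability but makes the law of the output independent of the codeword, so that
    about [snr^(rT)] codewords cannot be told apart.

    Achievability: antenna [t] alone transmits in channel use [t], and the [n] complex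
    symbols have [2n] real coordinates in [[1, 2]].  A greedy choice yields [M] points
    whose coordinatewise differences all have product at least [1/M] up to logarithms.
    A minimum distance decoder errs only if the noise is large, or if
    [prod_i |g_i h_i|^2] is at most [M snr^(-n)] up to smaller powers.  Since a squared
    modulus [|g_i|^2] is below [x] with probability [O(x)], the latter has probability
    [(M snr^(-n))^(1-o(1))]. *)
From HB Require Import structures.
Require Import Defs.
From mathcomp Require Import ring lra measurable_realfun.

Set Implicit Arguments.
Unset Strict Implicit.
Unset Printing Implicit Defensive.

Local Open Scope ring_scope.

(** * Greedy codes with large product distance *)

(** Neither half uses mutual information: both compare probabilities for one code at one SNR with
    explicit constants, and exponents appear only at the end.

    In the converse the widened noise law is fixed before the codeword, so the disjoint decision
    regions share a single unit of mass. The power constraint is only an average over codewords, so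
    Markov's inequality discards a quarter of them. The kept fraction must exceed 1/2, because at
    [r = 0] there may be just two codewords. Letting only the [g_i] fade is enough, since [|g_i|^2]
    and [|g_i h_i|^2] are small with the same exponent.

    In the achievability part no union bound over wrong codewords is taken. Decoding [m'] instead of
    [m] bounds, in each channel use, [|g_t h_t|^2] times the squared symbol difference. Multiplying
    over [t] leaves only the product of the differences, bounded below uniformly in [m'], so all
    errors lie in one fading event. Since [u^2 + v^2 >= |u v|], the product over the [2n] real
    coordinates may replace that over complex symbols, and [M] points of a [2n]-dimensional cube can
    reach product distance about [1/M]. *)

Lemma independent_set_ex (T : finType) (r : rel T) (B M : nat) :
  (0 < B)%N -> reflexive r -> symmetric r ->
  (forall x, #|[set y | r x y]| <= B)%N -> (M * B <= #|T|)%N ->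
  exists S : {set T}, (M <= #|S|)%N /\
    {in S &, forall x y, x != y -> ~~ r x y}.
Proof.
move=> B0 rr rs rB MB.
pose ind (S : {set T}) :=
  [forall x, forall y, [&& x \in S, y \in S & x != y] ==> ~~ r x y].
have ind0 : ind finset.set0.
  by apply/forallP => x; apply/forallP => y; rewrite inE.
have [S maxS _] := maxset_exists ind0.
have indS := maxsetp maxS.
exists S; split; last first.
  move=> x y xS yS xy; have /forallP/(_ x)/forallP/(_ y) := indS.
  by rewrite xS yS xy.
rewrite -(leq_pmul2r B0); apply: (leq_trans MB).
(* By maximality every point outside [S] is related to a point of [S]. Hence the neighbourhoods of
   [S], of at most [B] points each, cover [T]. *)
have cov : [set: T] \subset \bigcup_(x in S) [set y | r x y].
  apply/fintype.subsetP => y _; apply/finset.bigcupP.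
  have [yS|yS] := boolP (y \in S); first by exists y; rewrite ?inE.
  apply: contrapT => yN.
  have yr x : x \in S -> ~~ r x y.
    by move=> xS; apply/negP => xy; apply: yN; exists x; rewrite ?inE.
  have /maxsetsup : ind (y |: S).
    apply/forallP => a; apply/forallP => b; apply/implyP.
    rewrite !inE => /and3P[/orP[/eqP->|aS] /orP[/eqP->|bS]]; rewrite ?eqxx//.
    - by move=> _; rewrite rs yr.
    - by move=> _; rewrite yr.
    - move=> ab; have /forallP/(_ a)/forallP/(_ b) := indS.
      by rewrite aS bS ab.
  move=> /(_ _ maxS (finset.subsetUr _ _)) => SE.
  by move: yS; rewrite -SE setU11.
rewrite -cardsT (leq_trans (subset_leq_card cov))//.
rewrite (@leq_trans (\sum_(x in S) #|[set y | r x y]|))//.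
  elim/big_rec2: _ => [|x k A _ h]; first by rewrite cards0.
  by rewrite (leq_trans (leq_card_setU _ _))// leq_add2l.
by rewrite -sum_nat_const; exact: leq_sum.
Qed.

Section ProductDistance.
Context {R : realType}.

Lemma harmonic_le (Q : nat) : (0 < Q)%N ->
  \sum_(0 <= j < Q) (j.+1%:R)^-1 <= 1 + ln Q%:R :> R.
Proof.
case: Q => // Q _; elim: Q => [|Q IH].
  by rewrite big_nat1 ln1 invr1 addr0.
rewrite big_nat_recr//= (le_trans (lerD IH (lexx _)))// -addrA lerD2l.
have q0 : 0 < Q.+1%:R :> R by rewrite ltr0n.
have q1 : 0 < Q.+2%:R :> R by rewrite ltr0n.
rewrite -lerBrDl -lerN2 opprB -ln_div ?posrE//.
have -> : Q.+1%:R / Q.+2%:R = 1 + - Q.+2%:R^-1 :> R.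
  rewrite -[Q.+2%:R]natr1; move: q0; set x := Q.+1%:R => x0.
  by field; apply/eqP; lra.
by apply: le_ln1Dx; rewrite ltrN2 invf_lt1// ltr1n.
Qed.

(** Read outward from [a], each side is dominated term by term by the beginning of the harmonic sum;
    the left side starts at 1/2 because [a] is counted on the right. *)
Lemma sum_inv_dist_le (Q a : nat) : (a <= Q)%N ->
  \sum_(0 <= k < Q) (`|k%:R - a%:R| + 1)^-1 <=
  2 * (\sum_(0 <= j < Q) (j.+1%:R)^-1) :> R.
Proof.
move=> aQ; rewrite (big_cat_nat (n := a))//= mulr_natl mulr2n lerD//.
  rewrite big_nat_rev/= add0n [leRHS](big_cat_nat (n := a))//=.
  rewrite -[leLHS]addr0 lerD//; last by rewrite sumr_ge0// => j _; rewrite invr_ge0.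
  rewrite big_nat_cond [leRHS]big_nat_cond; apply: ler_sum => k.
  rewrite andbT => /andP[_ ka].
  rewrite lef_pV2 ?posrE ?ltr0n//.
  rewrite distrC natrB// opprB addrCA subrr addr0 ger0_norm//.
  by rewrite natr1 ler_nat.
rewrite -{1}[a]add0n big_addn [leRHS](big_cat_nat (n := (Q - a)%N)) ?leq_subr//=.
rewrite -[leLHS]addr0 lerD//; last by rewrite sumr_ge0// => j _; rewrite invr_ge0.
apply: ler_sum => k _.
by rewrite natrD addrK ger0_norm// natr1.
Qed.

(** The base [4 + 8 * N] is what [ln q <= N * (q^(1/N) - 1)] produces when [4 * (1 + 2 * ln q)] is
    compared with a multiple of [q^(1/N)]. *)
Definition grid_const (N : nat) : nat := ((4 + 8 * N) ^ N)%N.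

(** The square leaves a spare factor [grid_const N * M] to beat the logarithmic loss, which itself
    depends on the grid size. *)
Definition grid_size (N M : nat) : nat := ((grid_const N * M) ^ 2)%N.

(* Loss factor of the greedy code with respect to the ideal product distance [M^-1]. *)
Definition grid_loss (N M : nat) : R := (4 * (1 + ln (grid_size N M)%:R)) ^+ N.

Lemma grid_size_gt0 N M : (0 < M)%N -> (0 < grid_size N M)%N.
Proof. by move=> M0; rewrite /grid_size /grid_const !expn_gt0 muln_gt0 M0 expn_gt0. Qed.

Lemma grid_loss_gt0 N M : (0 < M)%N -> 0 < grid_loss N M.
Proof.
move=> M0; rewrite exprn_gt0// mulr_gt0// ltr_wpDr// ln_ge0//.
by rewrite ler1n grid_size_gt0.
Qed.

(** With [q = grid_const N * M] the loss is [(4 * (1 + 2 * ln q)) ^+ N], and bounding [ln q] through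
    [q^(1/N)] makes it at most [grid_const N * q]. The inequality is what forces far points to
    differ in every coordinate in [product_distance_code]. *)
Lemma grid_size_ge N M : (0 < N)%N -> (0 < M)%N ->
  M%:R * grid_loss N M <= (grid_size N M)%:R :> R.
Proof.
move=> N0 M0; set q : R := (grid_const N * M)%:R.
have qE : q = (grid_const N)%:R * M%:R by rewrite /q natrM.
have q1 : 1 <= q by rewrite /q ler1n muln_gt0 M0 /grid_const expn_gt0.
have N0' : 0 < N%:R :> R by rewrite ltr0n.
have -> : (grid_size N M)%:R = q * q :> R by rewrite /grid_size natrX expr2.
have q0 : 0 < q by rewrite (lt_le_trans ltr01).
suff h : grid_loss N M <= (grid_const N)%:R * q.
  rewrite (_ : q * q = M%:R * ((grid_const N)%:R * q)) ?ler_wpM2l//.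
  by rewrite {1}qE; ring.
have -> : grid_loss N M = (4 * (1 + 2 * ln q)) ^+ N.
  by rewrite /grid_loss /grid_size natrX lnXn// (mulr_natl (ln q)).
pose x := q `^ (N%:R)^-1.
have xN : x ^+ N = q.
  by rewrite -powR_mulrn ?powR_ge0// -powRrM mulVf ?gt_eqF// powRr1// ltW.
have x1 : 1 <= x by rewrite -(powRr0 q) ler_powR// invr_ge0 ltW.
have lnx : ln q = N%:R * ln x by rewrite -xN lnXn ?mulr_natl// (lt_le_trans ltr01).
have lnx1 : N%:R * ln x <= N%:R * (x - 1).
  rewrite ler_wpM2l//; have := @le_ln1Dx R (x - 1).
  rewrite addrCA subrr addr0; apply.
  by rewrite ltrBrDl subrr (lt_le_trans ltr01).
have lnq0 : 0 <= ln q by rewrite ln_ge0.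
rewrite /grid_const natrX -[X in _ <= _ * X]xN -exprMn lerXn2r ?nnegrE//.
- by lra.
- by rewrite mulr_ge0// (le_trans ler01).
- by rewrite natrD natrM lnx; lra.
Qed.

(** A packing argument on the grid of [Q ^ N] points, where two points are close if the product of
    their coordinate distances is at most [D]. A neighbourhood has at most [D * L] points, so [M]
    pairwise far points exist. *)
Lemma product_distance_code (N M : nat) : (0 < N)%N -> (0 < M)%N ->
  exists x : 'I_M -> 'I_N -> R,
    (forall m t, 1 <= x m t <= 2) /\
    forall m m', m != m' ->
      (M%:R * grid_loss N M)^-1 <= \prod_t `|x m t - x m' t|.
Proof.
move=> N0 M0; set Q := grid_size N M; set L := grid_loss N M.
have Q0 : (0 < Q)%N by exact: grid_size_gt0.
have Q0' : 0 < Q%:R :> R by rewrite ltr0n.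
have L0 : 0 < L by exact: grid_loss_gt0.
have M0' : 0 < M%:R :> R by rewrite ltr0n.
have ML := grid_size_ge N0 M0; rewrite -/Q -/L in ML.
(* Chosen so that [M * (D * L)] is exactly the number [Q ^ N] of grid points. *)
pose D : R := Q%:R ^+ N / (M%:R * L).
have D0 : 0 < D by rewrite divr_gt0 ?exprn_gt0// mulr_gt0.
have DQ : Q%:R ^+ N.-1 <= D.
  rewrite /D ler_pdivlMr ?mulr_gt0// -[N in leRHS]prednK// exprSr.
  by rewrite ler_wpM2l// exprn_ge0.
pose G := {ffun 'I_N -> 'I_Q}.
(* The maximum with 1 makes two points sharing a coordinate close, as [D >= Q ^+ N.-1]. *)
pose w (a b : 'I_Q) : R := Num.max 1 `|a%:R - b%:R|.
have w1 a b : 1 <= w a b by rewrite /w le_max lexx.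
pose close (x y : G) := \prod_t w (x t) (y t) <= D.
have wQ a b : w a b <= Q%:R.
  rewrite /w ge_max ler1n Q0 /= ler_norml lerBrDl lerBlDl.
  have := ltn_ord a; have := ltn_ord b; rewrite -!(ltr_nat R).
  have : 0 <= a%:R :> R by []. have : 0 <= b%:R :> R by [].
  by move=> b0 a0 bQ aQ; apply/andP; split; lra.
have sum_w (a : 'I_Q) : \sum_(b < Q) (w a b)^-1 <= 4 * (1 + ln Q%:R).
  apply: (@le_trans _ _ (2 * \sum_(0 <= k < Q) (`|k%:R - a%:R| + 1)^-1)).
    rewrite big_mkord mulr_sumr; apply: ler_sum => b _.
    rewrite -[X in X * _]invrK -invfM lef_pV2 ?posrE; last 2 first.
    - by rewrite (lt_le_trans ltr01).
    - by rewrite mulr_gt0// ?invr_gt0// ltr_wpDl.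
    rewrite ler_pdivrMl// /w distrC mulr_natl mulr2n lerD// le_max lexx ?orbT//.
  have := sum_inv_dist_le (ltnW (ltn_ord a)).
  by have := harmonic_le Q0; lra.
have closeB x : (#|[set y | close x y]|%:R <= D * L :> R).
  rewrite -sum1_card natr_sum.
  (* Each close [y] contributes at least 1 to the new sum. The sum over all [y] then factors into
     one harmonic-type sum per coordinate. *)
  apply: (@le_trans _ _ (\sum_(y : G) D * \prod_t (w (x t) (y t))^-1)).
    rewrite big_mkcond; apply: ler_sum => y _; rewrite inE.
    have p0 : 0 < \prod_t w (x t) (y t).
      by apply: prodr_gt0 => t _; rewrite (lt_le_trans ltr01).
    rewrite prodfV; case: ifP => [|_]; last by rewrite mulr_ge0 ?invr_ge0 ?(ltW p0) ?(ltW D0).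
    by rewrite /close => xyD; rewrite ler_pdivlMr// mul1r.
  rewrite -mulr_sumr ler_wpM2l ?(ltW D0)//.
  rewrite -(bigA_distr_bigA (fun t b => (w (x t) b)^-1)).
  rewrite /L /grid_loss -/Q -[N in leRHS]card_ord -prodr_const.
  apply: ler_prod => t _; rewrite sum_w andbT sumr_ge0// => b _.
  by rewrite invr_ge0 (le_trans ler01).
have closexx : reflexive close.
  move=> x; rewrite /close big1; last first.
    by move=> t _; rewrite /w subrr normr0; apply/max_idPl.
  by rewrite (le_trans _ DQ)// exprn_ege1// ler1n.
have [S [MS Sfar]] : exists S : {set G}, (M <= #|S|)%N /\
    {in S &, forall x y, x != y -> ~~ close x y}.
  apply: (@independent_set_ex _ _ (Num.truncn (D * L))) => //.
  - rewrite truncn_gt0 (le_trans _ (closeB [ffun=> Ordinal Q0]))// ler1n.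
    by apply/card_gt0P; exists [ffun=> Ordinal Q0]; rewrite inE closexx.
  - by move=> x y; rewrite /close; congr (_ <= _); apply: eq_bigr => t _;
       rewrite /w distrC.
  - by move=> x; rewrite truncn_ge_nat// mulr_ge0 ?(ltW D0) ?(ltW L0).
  - rewrite card_ffun !card_ord -(ler_nat R) natrM natrX.
    apply: (@le_trans _ _ (M%:R * (D * L))).
      by rewrite ler_wpM2l// truncn_le// mulr_ge0 ?(ltW D0) ?(ltW L0).
    by rewrite le_eqVlt; apply/orP; left; apply/eqP; rewrite /D; field; rewrite !gt_eqF.
pose f (m : 'I_M) : G := nth [ffun=> Ordinal Q0] (enum S) m.
have fm (m : 'I_M) : (m < size (enum S))%N.
  by rewrite -cardE (leq_trans (ltn_ord m)).
have fS m : f m \in S by rewrite -mem_enum mem_nth.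
have f_inj : injective f.
  by move=> m m' /eqP; rewrite nth_uniq ?enum_uniq// => /eqP/val_inj.
exists (fun m t => 1 + (f m t)%:R / Q%:R); split => [m t|m m' mm'].
  rewrite lerDl divr_ge0//= -[2]/(1 + 1) lerD2l ler_pdivrMr// mul1r ler_nat.
  exact/ltnW/ltn_ord.
have /negP : ~~ close (f m) (f m').
  by apply: Sfar => //; rewrite (inj_eq f_inj).
move=> /negP; rewrite /close -ltNge => farD.
(* At a shared coordinate [w] equals 1 and the others contribute at most [Q ^ N.-1 <= D], so the
   points would be close. Hence all integer differences are at least 1 and the maximum in [w] is
   never active. *)
have fne t : f m t != f m' t.
  apply/eqP => ft; have := lt_le_trans farD; move=> /(_ (Q%:R ^+ N.-1)).
  rewrite (bigD1 t)//= {1}/w ft subrr normr0 (max_idPl _)// mul1r.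
  have : \prod_(i < N | i != t) w (f m i) (f m' i) <= Q%:R ^+ N.-1.
    apply: (@le_trans _ _ (\prod_(i < N | i != t) Q%:R)).
      by apply: ler_prod => i _; rewrite wQ andbT (le_trans ler01).
    by rewrite prodr_const (eq_card (B := predC1 t))// cardC1 card_ord.
  by move=> h /(_ h); rewrite ltNge DQ.
have -> : \prod_t `|1 + (f m t)%:R / Q%:R - (1 + (f m' t)%:R / Q%:R)| =
    \prod_t w (f m t) (f m' t) / Q%:R ^+ N.
  rewrite (_ : Q%:R ^+ N = \prod_(t < N) Q%:R); last first.
    by rewrite prodr_const card_ord.
  rewrite -prodf_div; apply: eq_bigr => t _.
  rewrite opprD addrACA subrr add0r -mulrBl normrM normfV (ger0_norm (ltW Q0')).
  congr (_ / _); rewrite /w; apply/esym/max_idPr.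
  have := fne t; rewrite -val_eqE /=; move: (f m t : nat) (f m' t : nat) => a b.
  rewrite neq_lt => /orP[] ab.
    by rewrite distrC -natrB ?(ltnW ab)// ger0_norm// ler1n subn_gt0.
  by rewrite -natrB ?(ltnW ab)// ger0_norm// ler1n subn_gt0.
rewrite ler_pdivlMr ?exprn_gt0// mulrC; exact: ltW.
Qed.

End ProductDistance.

(** * Gaussian measures on the line *)

Local Open Scope classical_set_scope.
Local Open Scope ring_scope.

Section NormalComparison.
Context {R : realType}.
Implicit Types (s x y rho : R) (A : set R).

Lemma lebesgue_measure_translate x A : measurable A ->
  pushforward (@lebesgue_measure R)
    ((fun y => y + x) : _ -> measurableTypeR R) A = lebesgue_measure A.
Proof.
move=> mA; apply/esym/lebesgue_measure_unique => //=.
- exact: measurable_funD.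
- move=> mD _ [[a b]] _ <-; rewrite /pushforward.
  have -> : (fun y => y + x) @^-1` `]a, b] = `]a - x, b - x]%classic.
    by apply/seteqP; split => y /=; rewrite !in_itv /= ltrBlDr lerBrDr.
  rewrite !lebesgue_measure_itv/= !lte_fin ltrD2r.
  by rewrite -!EFinB (_ : b - x - (a - x) = b - a)//; ring.
Qed.

Lemma normal_prob_translate s x A : measurable A ->
  normal_prob 0 s [set y | A (y + x)] =
  (\int[lebesgue_measure]_(y in A) (normal_pdf 0 s (y - x))%:E)%E.
Proof.
move=> mA; rewrite /normal_prob.
pose phi : R -> measurableTypeR R := fun y => y + x.
have mphi : measurable_fun setT phi by exact: measurable_funD.
transitivity (\int[pushforward lebesgue_measure phi]_(y in A)
    (normal_pdf 0 s (y - x))%:E)%E.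
  rewrite ge0_integral_pushforward//.
  - by apply: eq_integral => y _ /=; rewrite /phi addrK.
  - apply/measurable_funTS/measurableT_comp => //.
    apply: (measurableT_comp (measurable_normal_pdf 0 s)).
    exact: measurable_funD.
  - by move=> y _; rewrite lee_fin normal_pdf_ge0.
apply: eq_measure_integral => //= B mB _; exact: lebesgue_measure_translate.
Qed.

(* [y ^+ 2 <= (1 + rho) * ((y - x) ^+ 2 + x ^+ 2 / rho)]. *)
Lemma normal_pdf_translate_le s rho x y : 0 < s -> 0 < rho ->
  normal_pdf 0 s (y - x) <=
  expR (x ^+ 2 / (s ^+ 2 * rho *+ 2)) * Num.sqrt (1 + rho) *
  normal_pdf 0 (s * Num.sqrt (1 + rho)) y.
Proof.
move=> s0 r0.
have r1 : 0 < 1 + rho by rewrite addr_gt0.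
have q0 : 0 < Num.sqrt (1 + rho) by rewrite sqrtr_gt0.
have sq0 : 0 < s * Num.sqrt (1 + rho) by rewrite mulr_gt0.
rewrite !normal_pdfE ?gt_eqF// /normal_peak /normal_fun.
rewrite exprMn sqr_sqrtr ?(ltW r1)// !subr0.
have -> : s ^+ 2 * (1 + rho) * pi *+ 2 = (s ^+ 2 * pi *+ 2) * (1 + rho).
  by rewrite -!mulrnAr; ring.
have p0 : 0 < s ^+ 2 * pi *+ 2 :> R.
  by rewrite pmulrn_lgt0// mulr_gt0 ?exprn_gt0 ?pi_gt0.
rewrite sqrtrM ?(ltW p0)// invfM.
set p := (Num.sqrt (s ^+ 2 * _ *+ 2))^-1.
have p1 : 0 <= p by rewrite invr_ge0 sqrtr_ge0.
set q := Num.sqrt _ in q0 *.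
rewrite [leRHS](_ : _ = p * expR (x ^+ 2 / (s ^+ 2 * rho *+ 2)) *
   expR (- y ^+ 2 / (s ^+ 2 * (1 + rho) *+ 2))); last first.
  by field; rewrite gt_eqF.
rewrite -mulrA ler_wpM2l// -expRD ler_expR.
have s20 : 0 < s ^+ 2 by rewrite exprn_gt0.
rewrite -subr_ge0 (_ : _ - _ = (s ^+ 2 * rho * (1 + rho) *+ 2)^-1 *
   (rho * y - (1 + rho) * x) ^+ 2); last first.
  by field; rewrite ?gt_eqF.
by rewrite mulr_ge0 ?sqr_ge0// invr_ge0 ltW// pmulrn_lgt0// !mulr_gt0.
Qed.

(** The one-dimensional noise widening: [x] enters the right side only through the constant, so one
    wider Gaussian dominates all shifts of bounded size. *)
Lemma normal_prob_translate_le s rho x A : 0 < s -> 0 < rho -> measurable A ->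
  (normal_prob 0%R s [set y | A (y + x)%R] <=
   (expR (x ^+ 2 / (s ^+ 2 * rho *+ 2)) * Num.sqrt (1 + rho))%:E *
   normal_prob 0%R (s * Num.sqrt (1 + rho))%R A)%E.
Proof.
move=> s0 r0 mA; rewrite normal_prob_translate// /normal_prob.
rewrite -ge0_integralZl_EFin//; last 2 first.
- by move=> y _; rewrite lee_fin normal_pdf_ge0.
- apply/measurable_funTS/measurableT_comp => //.
  exact: measurable_normal_pdf.
apply: ge0_le_integral => //.
- by move=> y _; rewrite lee_fin normal_pdf_ge0.
- apply/measurable_funTS/measurableT_comp => //.
  apply: (measurableT_comp (measurable_normal_pdf 0 s)).
  exact: measurable_funD.
- apply/measurable_funTS; apply: emeasurable_funM => //.
  by apply/measurable_EFinP; exact: measurable_normal_pdf.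
- by move=> y _; rewrite -EFinM lee_fin; exact: normal_pdf_translate_le.
Qed.

End NormalComparison.

Section NormalBounds.
Context {R : realType}.
Implicit Types (s x a : R).

(** Within one standard deviation the density is at least [expR (- 2^-1)] times its peak. The
    resulting constant does not depend on [s]. *)
Lemma normal_prob_itv_ge s a : 0 < s -> 0 <= a <= 1 ->
  ((expR (- 2^-1) * 2 / Num.sqrt (pi *+ 2) * a)%:E <=
   normal_prob 0%R s `[(- (a * s))%R, (a * s)%R])%E.
Proof.
move=> s0 /andP[a0 a1].
have -> : expR (- 2^-1) * 2 / Num.sqrt (pi *+ 2) * a =
    normal_peak s * expR (- 2^-1) * (a * s - - (a * s)).
  rewrite /normal_peak -mulrnAr sqrtrM ?sqr_ge0// sqrtr_sqr gtr0_norm//.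
  by field; rewrite ?gt_eqF// sqrtr_gt0 pmulrn_lgt0// pi_gt0.
have as0 : 0 <= a * s by rewrite mulr_ge0// ltW.
rewrite EFinM.
have -> : (a * s - - (a * s))%:E =
    lebesgue_measure (`[- (a * s), a * s]%classic : set R).
  rewrite lebesgue_measure_itv/= lte_fin; case: ifPn => //.
  by rewrite -leNgt => h; congr (_%:E); lra.
rewrite -integral_cst//; apply: ge0_le_integral => //.
- by move=> y _; rewrite lee_fin mulr_ge0 ?normal_peak_ge0 ?expR_ge0.
- by apply/measurable_funTS/measurable_EFinP; exact: measurable_normal_pdf.
- move=> y /=; rewrite in_itv/= => /andP[y1 y2].
  rewrite normal_pdfE ?gt_eqF// lee_fin ler_wpM2l ?normal_peak_ge0//.
  rewrite ler_expR subr0 mulNr lerN2 ler_pdivrMr; last first.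
    by rewrite pmulrn_lgt0// exprn_gt0.
  rewrite (_ : 2^-1 * _ = s ^+ 2); last by field.
  rewrite -[leLHS]real_normK ?num_real//.
  rewrite lerXn2r ?nnegrE ?(ltW s0)//.
  have h : a * s <= s by rewrite ler_piMl// ltW.
  by rewrite ler_norml; apply/andP; split; lra.
Qed.

Lemma normal_prob_itv_le s x : 0 < s -> 0 <= x ->
  (normal_prob 0%R s `[(- x)%R, x] <= (normal_peak s * (x *+ 2))%:E)%E.
Proof.
move=> s0 x0; rewrite EFinM.
have -> : (x *+ 2)%:E = lebesgue_measure (`[- x, x]%classic : set R).
  rewrite lebesgue_measure_itv/= lte_fin opprK; case: ifPn => //.
  by rewrite -leNgt => h; congr (_%:E); lra.
rewrite -integral_cst//; apply: ge0_le_integral => //.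
- by move=> y _; rewrite lee_fin normal_pdf_ge0.
- by apply/measurable_funTS/measurable_EFinP; exact: measurable_normal_pdf.
- by move=> y _; rewrite lee_fin; apply: normal_pdf_ub; rewrite gt_eqF.
Qed.

Lemma measurable_norm_gt a : measurable [set y : R | a < `|y|].
Proof.
have -> : [set y : R | a < `|y|] = (@Num.norm R R) @^-1` `]a, +oo[%classic.
  by apply/seteqP; split => y /=; rewrite in_itv/= andbT.
by rewrite -[X in measurable X]setTI; exact: normr_measurable.
Qed.

(** Beyond [a], half of the Gaussian exponent supplies the stated exponential and the other half is,
    up to [Num.sqrt 2], the density with doubled variance, whose total mass is 1. *)
Lemma normal_prob_tail_le s a : 0 < s -> 0 <= a ->
  (normal_prob 0%R s [set y | (a < `|y|)%R] <=
   (expR (- a ^+ 2 / (s ^+ 2 *+ 4)) * Num.sqrt 2)%:E)%E.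
Proof.
move=> s0 a0; set A := [set y : R | _].
have mA : measurable A by exact: measurable_norm_gt.
have q0 : 0 < Num.sqrt 2 :> R by rewrite sqrtr_gt0.
have sq0 : 0 < s * Num.sqrt 2 by rewrite mulr_gt0.
set k := _ * _.
have k0 : 0 <= k by rewrite mulr_ge0 ?expR_ge0 ?sqrtr_ge0.
have -> : k%:E = (k%:E * normal_prob 0%R (s * Num.sqrt 2)%R setT)%E.
  by rewrite probability_setT mule1.
apply: (@le_trans _ _ (k%:E * normal_prob 0%R (s * Num.sqrt 2)%R A)%E); last first.
  by rewrite lee_pmul2l ?fin_numE//; [apply: le_measure; rewrite ?inE|
   rewrite lte_fin mulr_gt0// expR_gt0].
rewrite /normal_prob -ge0_integralZl_EFin//; last 2 first.
- by move=> y _; rewrite lee_fin normal_pdf_ge0.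
- by apply/measurable_funTS/measurable_EFinP; exact: measurable_normal_pdf.
apply: ge0_le_integral => //.
- by move=> y _; rewrite lee_fin normal_pdf_ge0.
- by apply/measurable_funTS/measurable_EFinP; exact: measurable_normal_pdf.
- apply/measurable_funTS; apply: emeasurable_funM => //.
  by apply/measurable_EFinP; exact: measurable_normal_pdf.
move=> y Ay; rewrite -EFinM lee_fin !normal_pdfE ?gt_eqF//.
rewrite /normal_peak /normal_fun exprMn sqr_sqrtr// !subr0.
have p0 : 0 < s ^+ 2 * pi *+ 2 :> R.
  by rewrite pmulrn_lgt0// mulr_gt0 ?exprn_gt0 ?pi_gt0.
rewrite (_ : s ^+ 2 * 2 * pi *+ 2 = (s ^+ 2 * pi *+ 2) * 2); last by ring.
rewrite sqrtrM ?(ltW p0)// invfM /k.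
set p := (Num.sqrt (s ^+ 2 * _ *+ 2))^-1.
set e1 := expR _; set e2 := expR _; set e3 := expR _.
rewrite [leRHS](_ : _ = p * (e2 * e3)); last by field; rewrite gt_eqF.
rewrite ler_wpM2l ?invr_ge0 ?sqrtr_ge0// -expRD ler_expR.
have s20 : 0 < s ^+ 2 by rewrite exprn_gt0.
rewrite -subr_ge0 (_ : _ - _ = (y ^+ 2 - a ^+ 2) / (s ^+ 2 *+ 4)); last first.
  by field; rewrite gt_eqF.
rewrite divr_ge0 ?mulrn_wge0 ?(ltW s20)// subr_ge0.
by rewrite -[leRHS]real_normK ?num_real// lerXn2r ?nnegrE// ltW.
Qed.

End NormalBounds.

(** * Product laws and shifted coordinates *)

Section ProductLaw.
Context {R : realType} {J : finType}.

Definition cylinder : set (set (J -> R)) :=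
  [set A | exists j (B : set R), measurable B /\ A = (fun z => z j) @^-1` B].

Definition coords := g_sigma_algebraType cylinder.

Definition upd (z : J -> R) (j : J) (y : R) : J -> R :=
  fun i => if i == j then y else z i.

Definition box (A : J -> set R) : set coords := [set z | forall j, A j (z j)].

Lemma measurable_coord j : measurable_fun setT (fun z : coords => z j).
Proof.
move=> _ B mB; rewrite setTI; apply: sub_sigma_algebra.
by exists j, B.
Qed.

Lemma measurable_coordsP d (T : measurableType d) (f : T -> coords) :
  (forall j, measurable_fun setT (fun t => f t j)) -> measurable_fun setT f.
Proof.
move=> mf; apply: (@measurability _ _ _ _ setT f cylinder) => //.
move=> _ [_ [j [B [mB ->]] <-]].
by rewrite setTI -comp_preimage -[X in measurable X]setTI; exact: mf.
Qed.

Definition updp j (zy : coords * measurableTypeR R) : coords := upd zy.1 j zy.2.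

Lemma measurable_updp j : measurable_fun setT (updp j).
Proof.
apply: measurable_coordsP => i; rewrite /updp /upd; case: eqP => _.
  exact: measurable_snd.
exact: measurableT_comp (measurable_coord i) measurable_fst.
Qed.

HB.instance Definition _ j :=
  isMeasurableFun.Build _ _ _ _ (updp j) (measurable_updp j).

Lemma measurable_box A : (forall j, measurable (A j)) -> measurable (box A).
Proof.
move=> mA.
have -> : box A = \bigcap_(j in [set: J]) ((fun z : coords => z j) @^-1` A j).
  by apply/seteqP; split => z /= zA j; [move=> _|]; exact: zA.
apply: fin_bigcap_measurable => // j _.
by rewrite -[X in measurable X]setTI; exact: measurable_coord.
Qed.

(** Boxes are stable under intersection and generate the sigma-algebra. *)
Lemma box_measure_unique (m1 m2 : probability coords R) :
  (forall A, (forall j, measurable (A j)) -> m1 (box A) = m2 (box A)) ->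
  forall E, measurable E -> m1 E = m2 E.
Proof.
move=> m12 E mE.
apply: (measure_unique [set B | exists A, (forall j, measurable (A j)) /\ B = box A]
  (fun=> setT)) => //.
- apply/seteqP; split; last first.
    apply: smallest_sub; first exact: sigma_algebra_measurable.
    by move=> _ [A [mA ->]]; exact: measurable_box.
  apply: smallest_sub; first exact: smallest_sigma_algebra.
  move=> _ [j [B [mB ->]]]; apply: sub_sigma_algebra.
  exists (fun i => if i == j then B else setT); split.
    by move=> i; case: ifP.
  apply/seteqP; split => z /=; first by move=> zB i; case: eqP => // ->.
  by move/(_ j); rewrite eqxx.
- move=> _ _ [A [mA ->]] [B [mB ->]]; exists (fun j => A j `&` B j); split.
    by move=> j; exact: measurableI.
  by apply/seteqP; split => z /= => [[zA zB] j|zAB]; [|split => j; case: (zAB j)].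
- by move=> _; exists (fun=> setT); split => //; apply/seteqP; split.
- by rewrite bigcup_const.
- by move=> _ [A [mA ->]]; exact: m12.
- by move=> _; rewrite (le_lt_trans (probability_le1 _ _))// ltry.
Qed.

Definition product_law (Q : probability coords R)
    (mu : J -> probability (measurableTypeR R) R) :=
  forall A, (forall j, measurable (A j)) ->
    Q (box A) = (\big[*%E/1%E]_j mu j (A j))%E.

Lemma xsection_updp j (E : set coords) z :
  xsection (updp j @^-1` E) z = [set y | E (upd z j y)].
Proof. by apply/seteqP; split => y; rewrite /xsection/= inE. Qed.

Lemma measurable_updp_preimage j (E : set coords) : measurable E ->
  measurable (updp j @^-1` E).
Proof.
by move=> mE; rewrite -[X in measurable X]setTI; exact: measurable_updp.
Qed.

Lemma measurable_upd_section j (E : set coords) z : measurable E ->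
  measurable [set y | E (upd z j y)].
Proof.
move=> mE; rewrite -xsection_updp; apply: measurable_xsection.
exact: measurable_updp_preimage.
Qed.

Lemma measurable_fun_upd_section j (E : set coords)
    (nu : probability (measurableTypeR R) R) : measurable E ->
  measurable_fun setT (fun z : coords => nu [set y | E (upd z j y)]).
Proof.
move=> mE; rewrite (_ : (fun z => _) = nu \o xsection (updp j @^-1` E)).
  by apply: measurable_fun_xsection; exact: measurable_updp_preimage.
by apply/funext => z; rewrite /= xsection_updp.
Qed.

(** Coordinate [j] is replaced by an independent draw from [nu]. Defining this as an image of a
    product measure makes it a probability at once. *)
Definition resample (Q : probability coords R) j
    (nu : probability (measurableTypeR R) R) : probability coords R :=
  distribution (Q \x nu)%E (updp j).

Lemma resampleE (Q : probability coords R) j nu (E : set coords) :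
  resample Q j nu E = (\int[Q]_z nu [set y | E (upd z j y)])%E.
Proof.
rewrite /resample /distribution /pushforward /product_measure1.
by apply: eq_integral => z _; rewrite /= xsection_updp.
Qed.

Lemma resample_product_law Q mu j nu : product_law Q mu ->
  product_law (resample Q j nu) (fun i => if i == j then nu else mu i).
Proof.
move=> Qmu A mA; rewrite resampleE.
pose A' i := if i == j then setT else A i.
have mA' i : measurable (A' i) by rewrite /A'; case: ifP.
have AE z : [set y | box A (upd z j y)] = if z \in box A' then A j else set0.
  apply/seteqP; split => y /=.
    move=> zA; have -> : z \in box A'.
      rewrite inE => i; rewrite /A'; have := zA i; rewrite /upd.
      by case: eqP.
    by have := zA j; rewrite /upd eqxx.
  case: ifPn => //; rewrite inE => zA yA i; rewrite /upd.
  case: eqP => [->//|/eqP ij]; have := zA i.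
  by rewrite /A' (negbTE ij).
under eq_integral => z _.
  rewrite AE (_ : nu _ = (nu (A j) * (\1_(box A') z)%:E)%E); first over.
  by rewrite indicE; case: ifP => _; rewrite ?mule1// mule0 measure0.
rewrite ge0_integralZl//; last first.
  by apply/measurable_EFinP; apply: measurable_indic; exact: measurable_box.
rewrite integral_indic ?setIT; [|exact: measurableT|exact: measurable_box].
transitivity (nu (A j) * \big[*%E/1%E]_i mu i (A' i))%E.
  by congr (_ * _)%E; exact: Qmu.
rewrite (bigD1 j)//= [RHS](bigD1 j)//= eqxx /A' eqxx probability_setT mul1e.
by congr (_ * _)%E; apply: eq_bigr => i /negbTE ->.
Qed.

(** Redrawing a coordinate from its own law leaves all box probabilities unchanged. This plays the
    role of Fubini's theorem in one coordinate. *)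
Lemma product_law_resample Q mu j (E : set coords) : product_law Q mu ->
  measurable E -> Q E = (\int[Q]_z mu j [set y | E (upd z j y)])%E.
Proof.
move=> Qmu mE; rewrite -resampleE; apply: box_measure_unique mE => A mA.
rewrite (resample_product_law j (mu j) Qmu)// Qmu//.
by apply: eq_bigr => i _; case: eqP => [->|].
Qed.

End ProductLaw.

(** * Domination of shifted noise by one common law *)

Section ShiftedCoordinates.
Context {R : realType} {J : finType}.
Local Notation coords := (@coords R J).
Implicit Types (Q : probability coords R) (z : J -> R).

(** Invariance under this relation expresses dependence on the coordinates outside [D] only. In the
    converse [D] consists of the noise coordinates. *)
Definition agree_off (D : pred J) z z' := forall i, i \notin D -> z i = z' i.

Definition shift (js : seq J) (c : J -> coords -> R) (z : coords) : coords :=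
  fun i => if i \in js then z i + c i z else z i.

Lemma measurable_shift js c : (forall j, measurable_fun setT (c j)) ->
  measurable_fun setT (shift js c).
Proof.
move=> mc; apply: measurable_coordsP => i; rewrite /shift.
case: (i \in js); last exact: measurable_coord.
by apply: measurable_funD => //; exact: measurable_coord.
Qed.

(** Given the other coordinates, [c] is a constant, so [normal_prob_translate_le] applies section by
    section. *)
Lemma product_law_shift1_le Q mu j s rho b (c : coords -> R) (E : set coords) :
    0 < s -> 0 < rho ->
    product_law Q mu -> (forall A, mu j A = normal_prob 0 s A) ->
    measurable_fun setT c ->
    (forall z y, c (upd z j y) = c z) -> (forall z, E z -> c z ^+ 2 <= b) ->
    measurable E ->
  (Q [set z | E (upd z j (z j + c z)%R)] <=
   (expR (b / (s ^+ 2 * rho *+ 2)) * Num.sqrt (1 + rho))%:E *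
   resample Q j (normal_prob 0%R (s * Num.sqrt (1 + rho))%R) E)%E.
Proof.
move=> s0 rho0 Qmu muj mc cj Eb mE; set K := _ * _.
have K0 : 0 <= K by rewrite mulr_ge0 ?expR_ge0 ?sqrtr_ge0.
have updj z y : upd z j y j = y by rewrite /upd eqxx.
have updd z y y' : upd (upd z j y) j y' = upd z j y'.
  by apply/funext => i; rewrite /upd; case: eqP.
have mD : measurable [set z : coords | E (upd z j (z j + c z))].
  rewrite -[X in measurable X]setTI.
  pose f (z : coords) : coords := upd z j (z j + c z).
  suff : measurable_fun setT f by exact.
  apply: measurable_coordsP => i; rewrite /f /upd; case: eqP => _.
    by apply: measurable_funD => //; exact: measurable_coord.
  exact: measurable_coord.
rewrite (product_law_resample j Qmu mD) resampleE.
rewrite -ge0_integralZl_EFin//; last exact: measurable_fun_upd_section.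
apply: ge0_le_integral => //.
- exact: measurable_fun_upd_section.
- by apply: emeasurable_funM => //; exact: measurable_fun_upd_section.
move=> z _.
have -> : [set y | [set z | E (upd z j (z j + c z))] (upd z j y)] =
    [set y | [set y | E (upd z j y)] (y + c z)].
  by apply/seteqP; split => y /=; rewrite cj updd updj.
have mS := measurable_upd_section j z mE.
(* If [c z ^+ 2] exceeds [b] the section is empty, because [c] does not see coordinate [j] and [E]
   enforces the bound. *)
have [czb|czb] := leP (c z ^+ 2) b; last first.
  rewrite (_ : [set y | _] = set0) ?measure0 ?mule_ge0 ?lee_fin//.
  rewrite -subset0 => y /= /Eb; rewrite cj => h.
  by move: (le_lt_trans h czb); rewrite ltxx.
rewrite muj (le_trans (normal_prob_translate_le (c z) s0 rho0 mS))//.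
rewrite lee_wpmul2r// lee_fin ler_wpM2r ?sqrtr_ge0// ler_expR.
by rewrite ler_wpM2r// invr_ge0 mulrn_wge0// mulr_ge0 ?sqr_ge0// ltW.
Qed.

(* [Q'] is chosen before the shift [c], so that one [Q'] serves all codewords. *)
Lemma product_law_shift_le (D : pred J) s rho b : 0 < s -> 0 < rho ->
  forall (js : seq J) Q mu, uniq js -> {subset js <= D} ->
    product_law Q mu -> (forall j A, j \in js -> mu j A = normal_prob 0 s A) ->
  exists Q' : probability coords R,
    (forall (c : J -> coords -> R) (E : set coords),
       (forall j, measurable_fun setT (c j)) ->
       (forall j z z', agree_off D z z' -> c j z = c j z') ->
       measurable E ->
       (forall z, E z -> forall j, j \in js -> c j z ^+ 2 <= b) ->
       (Q (shift js c @^-1` E) <=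
       ((expR (b / (s ^+ 2 * rho *+ 2)) * Num.sqrt (1 + rho)) ^+ size js)%:E *
       Q' E)%E) /\
    (forall F : set coords, measurable F ->
      (forall z z', agree_off D z z' -> F z -> F z') -> Q' F = Q F).
Proof.
move=> s0 rho0; set K := _ * _.
have K0 : 0 <= K by rewrite mulr_ge0 ?expR_ge0 ?sqrtr_ge0.
elim => [|j js IH] Q mu /=.
  move=> _ _ Qmu _; exists Q; split => // c E _ _ mE _.
  rewrite expr0 mul1e (_ : _ @^-1` E = E)//.
move=> /andP[jjs ujs] jsD Qmu muN.
pose nu : probability (measurableTypeR R) R :=
  normal_prob 0%R (s * Num.sqrt (1 + rho))%R.
(* The induction continues from the law in which coordinate [j] is already widened, so [Q'] is
   determined before any shift is given. *)
have [||||Q' [Q'E Q'F]] :=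
  IH (resample Q j nu) (fun i => if i == j then nu else mu i) => //.
- by move=> i ijs; apply: jsD; rewrite inE ijs orbT.
- exact: resample_product_law.
- move=> i A ijs; case: eqP => [ij|_].
    by rewrite -ij ijs in jjs.
  by apply: muN; rewrite inE ijs orbT.
exists Q'; split=> [c E mc cD mE Eb|F mF FD]; last first.
  have agr y z : agree_off D z (upd z j y).
    move=> i iD; rewrite /upd; case: eqP => // ij.
    by move: iD; rewrite ij jsD// inE eqxx.
  have agrV y z : agree_off D (upd z j y) z.
    by move=> i /(agr y z) ->.
  rewrite Q'F// resampleE.
  transitivity (\int[Q]_z (\1_F z)%:E)%E; last by rewrite integral_indic// setIT.
  apply: eq_integral => z _; rewrite indicE; case: (boolP (z \in F)) => zF.
    rewrite (_ : [set y | _] = setT) ?probability_setT//.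
    by apply/seteqP; split => // y _; apply: (FD z) => //; rewrite inE in zF.
  rewrite (_ : [set y | _] = set0) ?measure0//.
  rewrite -subset0 => y /= Fy; move: zF; rewrite notin_setE; apply.
  exact: FD Fy.
have jD : j \in D by apply: jsD; rewrite inE eqxx.
have shiftD z : agree_off D (shift js c z) z.
  move=> i iD; rewrite /shift; case: ifP => // ijs.
  by move: iD; rewrite jsD// inE ijs orbT.
(* Coordinate [j] can be shifted separately from the others: it lies in [D], so moving it does not
   change the shifts still to come. *)
have -> : shift (j :: js) c @^-1` E =
    [set z | (shift js c @^-1` E) (upd z j (z j + c j z))].
  apply/seteqP; split => z /=; congr (E _); apply/funext => i;
    rewrite /shift /upd inE.
    case: (i =P j) => [->|] //=; first by rewrite (negbTE jjs).
    by case: ifP => // _ _; congr (_ + _); apply: cD => k kD; case: eqP => // kj;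
       move: kD; rewrite kj jD.
  case: (i =P j) => [->|] //=; first by rewrite (negbTE jjs).
  by case: ifP => // _ _; congr (_ + _); apply: cD => k kD; case: eqP => // kj;
     move: kD; rewrite kj jD.
have mE' : measurable (shift js c @^-1` E).
  by rewrite -[X in measurable X]setTI; exact: measurable_shift.
apply: (le_trans (product_law_shift1_le (b := b) s0 rho0 Qmu _ (mc j) _ _ mE')).
- by move=> A; apply: muN; rewrite inE eqxx.
- move=> z y; apply: cD => k kD; rewrite /upd; case: eqP => // kj.
  by move: kD; rewrite kj jD.
- move=> z /Eb /(_ j); rewrite inE eqxx => /(_ isT).
  by rewrite (cD j _ z).
rewrite [size _]/= (exprS K) [X in (_ <= X * _)%E]EFinM -muleA lee_wpmul2l ?lee_fin//.
apply: Q'E => // z Ez i ijs; apply: Eb => //; rewrite inE ijs orbT//.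
Qed.

End ShiftedCoordinates.

(** * Complex random variables and the law of the channel *)

Section ComplexMeasurability.
Context {R : realType} {d : measure_display} {T : measurableType d}.
Implicit Types f g : T -> R[i].

Definition part (b : bool) (z : R[i]) : R :=
  if b then complex.Im z else complex.Re z.

Definition cmeasurable f := forall b, measurable_fun setT (fun t => part b (f t)).

Lemma cmeasurable_cst z : cmeasurable (fun=> z).
Proof. by move=> b; exact: measurable_cst. Qed.

Lemma cmeasurableD f g :
  cmeasurable f -> cmeasurable g -> cmeasurable (fun t => f t + g t).
Proof.
move=> mf mg b.
rewrite (_ : (fun _ => _) = (fun t => part b (f t) + part b (g t))).
  by apply: measurable_funD; [exact: mf|exact: mg].
by apply/funext => t; case: b => /=; rewrite raddfD.
Qed.

Lemma cmeasurableN f : cmeasurable f -> cmeasurable (fun t => - f t).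
Proof.
move=> mf b.
rewrite (_ : (fun _ => _) = (fun t => - part b (f t))).
  by apply: measurableT_comp => //; exact: mf.
by apply/funext => t; case: b => /=; rewrite raddfN.
Qed.

Lemma cmeasurableM f g :
  cmeasurable f -> cmeasurable g -> cmeasurable (fun t => f t * g t).
Proof.
move=> mf mg [].
  rewrite (_ : (fun _ => _) = (fun t => part false (f t) * part true (g t) +
                                        part true (f t) * part false (g t))).
    by apply: measurable_funD; apply: measurable_funM; [exact: (mf false)|
      exact: (mg true)|exact: (mf true)|exact: (mg false)].
  by apply/funext => t /=; case: (f t) (g t) => [a b] [a' b'] /=.
rewrite (_ : (fun _ => _) = (fun t => part false (f t) * part false (g t) -
                                      part true (f t) * part true (g t))).
  by apply: measurable_funB; apply: measurable_funM; [exact: (mf false)|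
    exact: (mg false)|exact: (mf true)|exact: (mg true)].
by apply/funext => t /=; case: (f t) (g t) => [a b] [a' b'] /=.
Qed.

Lemma cmeasurable_sum (I : Type) (s : seq I) (F : I -> T -> R[i]) :
  (forall i, cmeasurable (F i)) -> cmeasurable (fun t => \sum_(i <- s) F i t).
Proof.
move=> mF; elim: s => [|i s IH].
  rewrite (_ : (fun _ => _) = fun=> 0); first exact: cmeasurable_cst.
  by apply/funext => t; rewrite big_nil.
rewrite (_ : (fun _ => _) = (fun t => F i t + \sum_(j <- s) F j t)).
  exact: cmeasurableD.
by apply/funext => t; rewrite big_cons.
Qed.

Lemma cmeasurable_normsq f : cmeasurable f ->
  measurable_fun setT (fun t => ComplexField.Normc.normc (f t) ^+ 2).
Proof.
move=> mf.
rewrite (_ : (fun _ => _) = (fun t => part false (f t) ^+ 2 + part true (f t) ^+ 2)).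
  by apply: measurable_funD; apply: measurable_funX; [exact: mf|exact: mf].
apply/funext => t; case: (f t) => x y.
by rewrite /= sqr_sqrtr// addr_ge0// sqr_ge0.
Qed.

Lemma cmeasurable_preimage f (A : set R[i]) :
  cmeasurable f -> complex_borel A -> measurable (f @^-1` A).
Proof.
move=> mf; move: A.
pose G : set (set R[i]) := [set A | measurable (f @^-1` A)].
apply: (@smallest_sub _ (sigma_algebra setT) _ G).
  split => //=; rewrite /G/=.
  - by rewrite preimage_set0.
  - by move=> A mA; rewrite setTD preimage_setC; exact: measurableC.
  - by move=> A mA; rewrite preimage_bigcup; exact: bigcup_measurable.
move=> A [B [mB [->|->]]] /=; rewrite /G/= -comp_preimage.
  by rewrite -[X in measurable X]setTI; exact: (mf false).
by rewrite -[X in measurable X]setTI; exact: (mf true).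
Qed.

Lemma coordinate_borel_preimage (V K : Type) (coord : K -> V -> R[i])
    (f : T -> V) (A : set V) :
  (forall k, cmeasurable (fun t => coord k (f t))) ->
  coordinate_borel coord A -> measurable (f @^-1` A).
Proof.
move=> mf; move: A.
pose G : set (set V) := [set A | measurable (f @^-1` A)].
apply: (@smallest_sub _ (sigma_algebra setT) _ G).
  split => //=; rewrite /G/=.
  - by rewrite preimage_set0.
  - by move=> A mA; rewrite setTD preimage_setC; exact: measurableC.
  - by move=> A mA; rewrite preimage_bigcup; exact: bigcup_measurable.
by move=> A [k [B [mB ->]]]; exact: (cmeasurable_preimage (mf k) mB).
Qed.

Lemma complex_borel_rect (A B : set R) : measurable A -> measurable B ->
  complex_borel [set z | A (complex.Re z) /\ B (complex.Im z)].
Proof.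
move=> mA mB.
have -> : [set z | A (complex.Re z) /\ B (complex.Im z)] =
    (@complex.Re R @^-1` A) `&` (@complex.Im R @^-1` B) by [].
have borelC (X : set R[i]) : complex_borel X -> complex_borel (~` X).
  by move=> mX; rewrite -setTD; exact: sigma_algebraCD.
rewrite -[_ `&` _]setCK setCI -bigcup2E.
apply: (borelC _); apply: sigma_algebra_bigcup => -[|[|k]] /=.
- apply: (borelC _); apply: sub_sigma_algebra.
  by exists A; split => //; left.
- apply: (borelC _); apply: sub_sigma_algebra.
  by exists B; split => //; right.
- exact: sigma_algebra0.
Qed.

Lemma is_CN_cmeasurable (P : probability T R) v (Z : T -> R[i]) :
  is_CN P v Z -> cmeasurable Z.
Proof.
move=> [mZ _] b _ B mB; rewrite setTI.
apply: (mZ (part b @^-1` B)); apply: sub_sigma_algebra.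
by exists B; split => //; case: b; [right|left].
Qed.

End ComplexMeasurability.

(** * The channel as a product law on real coordinates *)

Section ChannelLaw.
Context {R : realType} {d : measure_display} {Omega : measurableType d}.
Context (P : probability Omega R) (n T : nat).

Definition link : finType := ('I_n + 'I_n + 'I_T)%type.

(** Only the first [T] noise samples are kept of the infinite sequence, so the coordinate index is
    finite. *)
Definition key (k : link) : 'I_n + 'I_n + nat :=
  match k with inl k' => inl k' | inr t => inr (nat_of_ord t) end.

Lemma key_inj : injective key.
Proof. by move=> [k|t] [k'|t'] //= [] => [->//|/val_inj ->]. Qed.

Definition channel_coords (ch : channel n) (w : Omega) :
    @coords R (link * bool)%type :=
  fun kb => part kb.2 (channel_rv ch (key kb.1) w).

Definition link_law (v : R) (kb : link * bool) :
    probability (measurableTypeR R) R :=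
  normal_prob 0 (Num.sqrt ((if kb.1 is inr _ then 1 else v) / 2)).

Variables (v : R) (ch : @channel R d Omega n).
Hypothesis gP : forall i, is_CN P v (gain_g ch i).
Hypothesis hP : forall i, is_CN P v (gain_h ch i).
Hypothesis nP : forall t, is_CN P 1 (noise ch t).
Hypothesis indep : mutually_independent P (channel_rv ch).

Lemma channel_rv_CN (k : link) :
  is_CN P (if k is inr _ then 1 else v) (channel_rv ch (key k)).
Proof. by case: k => [[i|i]|t] /=. Qed.

Lemma channel_rv_cmeasurable k : cmeasurable (channel_rv ch k).
Proof.
case: k => [[i|i]|t] /=.
- exact: is_CN_cmeasurable (gP i).
- exact: is_CN_cmeasurable (hP i).
- exact: is_CN_cmeasurable (nP t).
Qed.

Lemma measurable_channel_coords : measurable_fun setT (channel_coords ch).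
Proof.
apply: measurable_coordsP => -[k b]; exact: channel_rv_cmeasurable.
Qed.

(** Independence between links comes from [mutually_independent], that between the real and
    imaginary parts of one link from [is_CN]; together they give a product over [link * bool]. *)
Lemma channel_coords_law : exists Q : probability (@coords R (link * bool)%type) R,
  (forall E, measurable E -> Q E = P (channel_coords ch @^-1` E)) /\
  product_law Q (link_law v).
Proof.
pose fm := isMeasurableFun.Build _ _ _ _ (channel_coords ch)
  measurable_channel_coords.
pose f : {mfun Omega >-> @coords R (link * bool)%type} :=
  HB.pack (channel_coords ch) fm.
exists (distribution P f); split => // A mA; rewrite /distribution /pushforward/=.
pose B (k : link) : set R[i] :=
  [set z | A (k, false) (complex.Re z) /\ A (k, true) (complex.Im z)].
(* The independence hypothesis wants a set for every noise time; times beyond [T] receive [setT]. *)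
pose A' (k : 'I_n + 'I_n + nat) : set R[i] :=
  match k with
  | inl k' => B (inl k')
  | inr t => if insub t is Some t' then B (inr t') else setT
  end.
have A'key k : A' (key k) = B k by case: k => //= t; rewrite valK.
have := indep (s := [seq key k | k <- enum link]) (A := A').
rewrite map_inj_uniq ?enum_uniq => [/(_ isT)|]; last exact: key_inj.
have mB k : complex_borel (B k) by apply: complex_borel_rect; exact: mA.
move=> /(_ _)/wrap[|H].
  move=> [k|t] //=; case: insubP => //= _.
  have := @complex_borel_rect R setT setT measurableT measurableT.
  by rewrite (_ : [set z | _] = setT)//; apply/seteqP; split.
transitivity (P (\bigcap_(k in [set` [seq key k | k <- enum link]])
    (channel_rv ch k @^-1` A' k))).
  congr (P _); apply/seteqP; split => w /=.
    move=> wA _ /mapP[k _ ->]; rewrite A'key.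
    by split; [have := wA (k, false)|have := wA (k, true)].
  move=> wA [k b]; have := wA (key k).
  rewrite /= map_f ?mem_enum// => /(_ isT); rewrite A'key => -[w1 w2].
  by case: b.
rewrite H big_map big_enum /=.
rewrite [RHS](_ : _ = \big[*%E/1%E]_(k : link) \big[*%E/1%E]_(b : bool)
   link_law v (k, b) (A (k, b))); last first.
  by rewrite pair_bigA; apply: eq_bigr => -[].
apply: eq_bigr => k _; rewrite A'key big_bool /=.
have [_ ->] := channel_rv_CN k; [|exact: mA..].
by rewrite muleC.
Qed.

End ChannelLaw.

Local Notation cmod := ComplexField.Normc.normc.

Section ComplexModulus.
Context {R : realType}.
Implicit Types x y z : R[i].

Lemma cmod_ge0 z : 0 <= cmod z.
Proof. by case: z => a b; exact: sqrtr_ge0. Qed.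

Lemma cmodD x y : cmod (x + y) <= cmod x + cmod y.
Proof. exact: (@ler_normD _ (Rcomplex R)). Qed.

Lemma cmodM x y : cmod (x * y) = cmod x * cmod y.
Proof. exact: ComplexField.Normc.normcM. Qed.

Lemma cmod_sqE z : cmod z ^+ 2 = part false z ^+ 2 + part true z ^+ 2.
Proof. by case: z => a b; rewrite /= sqr_sqrtr// addr_ge0// sqr_ge0. Qed.

Lemma part_sq_le b z : part b z ^+ 2 <= cmod z ^+ 2.
Proof. by rewrite cmod_sqE; case: b; rewrite ?lerDl ?lerDr sqr_ge0. Qed.

Lemma cmod_sum (I : Type) (s : seq I) (F : I -> R[i]) :
  cmod (\sum_(i <- s) F i) <= \sum_(i <- s) cmod (F i).
Proof.
elim/big_rec2: _ => [|i x y _ h]; first by rewrite ComplexField.Normc.normc0.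
by rewrite (le_trans (cmodD _ _))// lerD2l.
Qed.

End ComplexModulus.

(** * Converse at a fixed signal-to-noise ratio *)

Lemma EFin_prod_le {R : realType} (I : finType) (f : I -> R) (g : I -> \bar R) :
  (forall i, 0 <= f i /\ ((f i)%:E <= g i)%E) ->
  ((\prod_i f i)%:E <= \big[*%E/1%E]_i g i)%E.
Proof.
move=> fg.
suff [] : 0 <= \prod_i f i /\ ((\prod_i f i)%:E <= \big[*%E/1%E]_i g i)%E by [].
elim/big_ind2: _ => [|x1 x2 y1 y2 [x10 x12] [y10 y12]|i _]; last exact: fg.
- by rewrite ler01.
- by split; [exact: mulr_ge0|rewrite EFinM lee_pmul// lee_fin].
Qed.

Section Converse.
Context {R : realType} {d : measure_display} {Omega : measurableType d}.
Context (P : probability Omega R) (n T : nat).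
Local Notation idx := (link n T * bool)%type.
Local Notation coords := (@coords R (link n T * bool)%type).

Definition fade (z : coords) (k : link n T) : R[i] :=
  Complex (z (k, false)) (z (k, true)).

Definition fading_row (z : coords) : 'rV[R[i]]_n :=
  \row_i (fade z (inl (inl i)) * fade z (inl (inr i))).

Definition noise_row (z : coords) : 'rV[R[i]]_T := \row_t fade z (inr t).

Lemma fade_channel_coords (ch : @channel R d Omega n) w k :
  fade (channel_coords ch w) k = channel_rv ch (key k) w.
Proof. by rewrite /fade /channel_coords /=; case: (channel_rv _ _ _). Qed.

Lemma fading_row_channel (ch : @channel R d Omega n) w :
  fading_row (channel_coords ch w) = channel_vector ch w.
Proof. by apply/rowP => i; rewrite !mxE !fade_channel_coords. Qed.

Lemma noise_row_channel (ch : @channel R d Omega n) w :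
  noise_row (channel_coords ch w) = noise_vector ch T w.
Proof. by apply/rowP => i; rewrite !mxE !fade_channel_coords. Qed.

Lemma fade_cmeasurable k : cmeasurable (fade ^~ k).
Proof. by move=> [] /=; exact: measurable_coord. Qed.

Definition is_noise : pred idx := fun kb => if kb.1 is inr _ then true else false.

Definition noise_indices : seq idx :=
  [seq (inr t, b) | t <- enum 'I_T, b <- [:: false; true]].

Lemma size_noise_indices : size noise_indices = (T * 2)%N.
Proof. by rewrite size_allpairs size_enum_ord. Qed.

Lemma uniq_noise_indices : uniq noise_indices.
Proof.
apply: allpairs_uniq; rewrite ?enum_uniq//.
by move=> [t b] [t' b'] _ _ [-> ->].
Qed.

Lemma mem_noise_indices t b : (inr t, b) \in noise_indices.
Proof.
apply/allpairsP; exists (t, b); rewrite mem_enum; split => //.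
by case: b; rewrite !inE.
Qed.

Lemma noise_indicesE kb : (kb \in noise_indices) = is_noise kb.
Proof.
case: kb => -[k|t] b; last by rewrite mem_noise_indices.
by apply/negbTE/negP => /allpairsP[[t b'] [_ _]].
Qed.

Lemma measurable_decode_error (ch : @channel R d Omega n) (c : @code R n T)
    (m : 'I_(ncodewords c)) :
  (forall k, cmeasurable (channel_rv ch k)) -> valid_code c ->
  measurable [set w | decode c (channel_vector ch w) (received ch m w) <> m].
Proof.
move=> mch [_ _ /(_ m) mD].
pose f w := (channel_vector ch w, received ch m w).
rewrite (_ : [set w | _] = ~` (f @^-1` [set z | decode c z.1 z.2 = m])); last first.
  by apply/seteqP; split.
apply: measurableC; apply: coordinate_borel_preimage mD.
have mH i : cmeasurable (fun w => gain_g ch i w * gain_h ch i w).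
  by apply: cmeasurableM; [exact: (mch (inl (inl i)))|exact: (mch (inl (inr i)))].
move=> [i|t] b /=.
  rewrite (_ : (fun _ => _) = (fun w => part b (gain_g ch i w * gain_h ch i w))).
    exact: mH.
  by apply/funext => w; rewrite mxE.
rewrite (_ : (fun _ => _) = (fun w => part b (theta c *
    \sum_i (gain_g ch i w * gain_h ch i w * codeword m i t) + noise ch t w))).
  move: b; apply: cmeasurableD; last exact: (mch (inr _)).
  apply: cmeasurableM; first exact: cmeasurable_cst.
  by apply: cmeasurable_sum => i; apply: cmeasurableM => //; exact: cmeasurable_cst.
apply/funext => w; rewrite /received !mxE; congr (part b (_ * _ + _)).
by apply: eq_bigr => i _; rewrite mxE.
Qed.

Lemma error_probability_le1 (ch : @channel R d Omega n) (c : @code R n T) :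
  (forall k, cmeasurable (channel_rv ch k)) -> valid_code c ->
  error_probability P ch c <= 1.
Proof.
move=> mch vc; have M0 : 0 < (ncodewords c)%:R :> R.
  by case: vc => M1 _ _; rewrite ltr0n ltnW.
rewrite /error_probability ler_pdivrMl// mulr1 -[X in _ <= X%:R]card_ord -sum1_card natr_sum.
apply: ler_sum => m _; have mE := measurable_decode_error m mch vc.
by rewrite -lee_fin fineK ?fin_num_measure// probability_le1.
Qed.

Definition signal (c : @code R n T) (m : 'I_(ncodewords c)) (z : coords) :
    'rV[R[i]]_T :=
  theta c *: (fading_row z *m codeword m).

(** The real coordinates of the noiseless output, extended by 0 to the fading links so as to serve
    as the displacement in [shift]. *)
Definition signal_part (c : @code R n T) (m : 'I_(ncodewords c)) (kb : idx)
    (z : coords) : R :=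
  if kb.1 is inr t then part kb.2 (signal m z 0 t) else 0.

Lemma fading_row_agree z z' :
  agree_off is_noise z z' -> fading_row z = fading_row z'.
Proof. by move=> zz'; apply/rowP => i; rewrite !mxE /fade !zz'. Qed.

Lemma agree_shift (s : idx -> coords -> R) z :
  agree_off is_noise z (shift noise_indices s z).
Proof.
by move=> [[k|t] b] //; rewrite /shift noise_indicesE.
Qed.

(** After the shift [noise_row] is the received row, so correct decoding of [m] becomes the preimage
    under a shift of a region [decision m], and these regions are disjoint. *)
Lemma noise_row_shift (c : @code R n T) (m : 'I_(ncodewords c)) z :
  noise_row (shift noise_indices (signal_part m) z) = signal m z + noise_row z.
Proof.
apply/rowP => t; rewrite [in LHS]mxE [in RHS]mxE.
rewrite (_ : noise_row z 0 t = fade z (inr t)); last by rewrite mxE.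
rewrite /fade /shift !mem_noise_indices /signal_part [in LHS]/=.
case: (signal m z 0 t) => x y.
by apply/eqP; rewrite eq_complex /= ![_ + z _]addrC !eqxx.
Qed.

Lemma measurable_signal_part (c : @code R n T) (m : 'I_(ncodewords c)) kb :
  measurable_fun setT (signal_part m kb).
Proof.
case: kb => -[k|t] b; rewrite /signal_part /=; first exact: measurable_cst.
rewrite (_ : (fun _ => _) = (fun z => part b (theta c *
  \sum_i (fade z (inl (inl i)) * fade z (inl (inr i)) * codeword m i t)))).
  move: b; apply: cmeasurableM; first exact: cmeasurable_cst.
  apply: cmeasurable_sum => i; apply: cmeasurableM; last exact: cmeasurable_cst.
  by apply: cmeasurableM; exact: fade_cmeasurable.
apply/funext => z; congr (part b _); rewrite !mxE; congr (_ * _).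
by apply: eq_bigr => i _; rewrite mxE.
Qed.

Definition decision (c : @code R n T) (m : 'I_(ncodewords c)) : set coords :=
  [set z | decode c (fading_row z) (noise_row z) = m].

Lemma measurable_decision (c : @code R n T) (m : 'I_(ncodewords c)) :
  valid_code c -> measurable (decision m).
Proof.
move=> [_ _ /(_ m) mD].
apply: (@coordinate_borel_preimage _ _ _ _ _ _ (fun z => (fading_row z, noise_row z))
  _ _ mD).
move=> [i|t] b /=.
  rewrite (_ : (fun _ => _) = (fun z =>
    part b (fade z (inl (inl i)) * fade z (inl (inr i))))).
    by move: b; apply: cmeasurableM; exact: fade_cmeasurable.
  by apply/funext => z; rewrite mxE.
rewrite (_ : (fun _ => _) = (fun z => part b (fade z (inr t)))).
  exact: fade_cmeasurable.
by apply/funext => z; rewrite mxE.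
Qed.

(** A box instead of a condition on moduli makes the probability a product of one-dimensional ones.
    The noise is left free, so the shifts preserve the event. *)
Definition deep_fade (a s : R) : set coords :=
  box (fun kb => match kb.1 with
    | inl (inl _) => `[(- (a * s)), a * s]%classic
    | inl (inr _) => `[- s, s]%classic
    | inr _ => setT
    end).

Lemma measurable_deep_fade a s : measurable (deep_fade a s).
Proof. by apply: measurable_box => -[[[i|i]|t] b] /=. Qed.

Lemma deep_fade_agree a s z z' :
  agree_off is_noise z z' -> deep_fade a s z -> deep_fade a s z'.
Proof.
by move=> zz' Fz [[[i|i]|t] b] //=; rewrite -zz'//;
  [exact: (Fz (inl (inl i), b))|exact: (Fz (inl (inr i), b))].
Qed.

Lemma fading_row_le a v z i : 0 <= v -> 0 <= a -> deep_fade a (Num.sqrt (v / 2)) z ->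
  cmod (fading_row z 0 i) <= a * v.
Proof.
move=> v0 a0 Fz; rewrite mxE cmodM.
have v2 : 0 <= v / 2 by rewrite divr_ge0.
have sqle (x y : R) : 0 <= y -> x \in `[- y, y] -> x ^+ 2 <= y ^+ 2.
  move=> y0; rewrite in_itv/= -ler_norml => xy.
  by rewrite -[leLHS]real_normK ?num_real// lerXn2r ?nnegrE.
have -> : a * v = (a * Num.sqrt v) * Num.sqrt v.
  by rewrite -mulrA -expr2 sqr_sqrtr.
apply: ler_pM; rewrite ?cmod_ge0//.
  rewrite -(@ler_pXn2r _ 2) ?nnegrE ?cmod_ge0 ?mulr_ge0 ?sqrtr_ge0// cmod_sqE.
  have h b := sqle _ _ (mulr_ge0 a0 (sqrtr_ge0 (v / 2))) (Fz (inl (inl i), b)).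
  apply: (le_trans (lerD (h false) (h true))).
  by rewrite !exprMn !sqr_sqrtr//; rewrite le_eqVlt; apply/orP; left; apply/eqP; field.
rewrite -(@ler_pXn2r _ 2) ?nnegrE ?cmod_ge0 ?mulr_ge0 ?sqrtr_ge0// cmod_sqE.
have h b := sqle _ _ (sqrtr_ge0 (v / 2)) (Fz (inl (inr i), b)).
apply: (le_trans (lerD (h false) (h true))).
by rewrite !sqr_sqrtr//; rewrite le_eqVlt; apply/orP; left; apply/eqP; field.
Qed.

Lemma entry_le_frobenius p q (A : 'M[R[i]]_(p, q)) i j :
  cmod (A i j) <= Num.sqrt (frobenius_sq A).
Proof.
rewrite -[leLHS]ger0_norm ?cmod_ge0// -sqrtr_sqr ler_wsqrtr//.
rewrite /frobenius_sq (bigD1 i)//= (bigD1 j)//= -addrA lerDl addr_ge0//.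
  by apply: sumr_ge0 => j' _; rewrite sqr_ge0.
by apply: sumr_ge0 => i' _; apply: sumr_ge0 => j' _; rewrite sqr_ge0.
Qed.

Lemma frobenius_ge0 p q (A : 'M[R[i]]_(p, q)) : 0 <= frobenius_sq A.
Proof. by apply: sumr_ge0 => i _; apply: sumr_ge0 => j _; rewrite sqr_ge0. Qed.

Lemma signal_part_le (c : @code R n T) (m : 'I_(ncodewords c)) a v B z kb :
  0 <= v -> 0 <= a -> deep_fade a (Num.sqrt (v / 2)) z ->
  frobenius_sq (theta c *: codeword m) <= B ->
  signal_part m kb z ^+ 2 <= (n%:R * a * v) ^+ 2 * B.
Proof.
move=> v0 a0 Fz XB.
have B0 : 0 <= B by rewrite (le_trans _ XB)// frobenius_ge0.
case: kb => -[k|t] b; rewrite /signal_part /=.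
  by rewrite expr0n/= mulr_ge0// sqr_ge0.
apply: (le_trans (part_sq_le _ _)).
rewrite -[B in leRHS]sqr_sqrtr// -exprMn lerXn2r ?nnegrE ?cmod_ge0 ?mulr_ge0 ?sqrtr_ge0//.
have -> : signal m z 0 t =
    \sum_i fading_row z 0 i * (theta c *: codeword m) i t.
  rewrite /signal [LHS]mxE [X in _ * X]mxE mulr_sumr; apply: eq_bigr => i _.
  rewrite (_ : (theta c *: codeword m) i t = theta c * codeword m i t); last first.
    by rewrite mxE.
  by rewrite mulrCA.
apply: (le_trans (cmod_sum _ _)).
have -> : n%:R * a * v * Num.sqrt B = \sum_(i < n) (a * v * Num.sqrt B).
  by rewrite sumr_const card_ord -mulr_natl; ring.
apply: ler_sum => i _; rewrite cmodM ler_pM ?cmod_ge0//.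
  exact: fading_row_le.
by rewrite (le_trans (entry_le_frobenius _ _ _))// ler_wsqrtr.
Qed.

(** Each antenna has four real coordinates: the two of [g] contribute [k * a] each and the two of
    [h] contribute [k] each, where [k] is the constant of [normal_prob_itv_ge]. *)
Lemma deep_fade_prob (Q : probability coords R) (a v : R) : 0 < v -> 0 <= a <= 1 ->
  product_law Q (@link_law R n T v) ->
  ((((expR (- 2^-1) * 2 / Num.sqrt (pi *+ 2)) ^+ 2 * a) ^+ (n * 2))%:E <=
    Q (deep_fade a (Num.sqrt (v / 2))))%E.
Proof.
move=> v0 a01 Qlaw; set k := _ / _.
have [a0 _] := andP a01.
have k0 : 0 <= k by rewrite !mulr_ge0 ?expR_ge0 ?invr_ge0 ?sqrtr_ge0.
have s0 : 0 < Num.sqrt (v / 2) by rewrite sqrtr_gt0 divr_gt0.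
rewrite Qlaw; last by move=> [[[i|i]|t] b] /=.
pose f (kb : idx) : R :=
  match kb.1 with inl (inl _) => k * a | inl (inr _) => k | inr _ => 1 end.
have f0 kb : 0 <= f kb by case: kb => -[[i|i]|t] b; rewrite /f/= ?mulr_ge0.
have -> : (k ^+ 2 * a) ^+ (n * 2) = \prod_kb f kb.
  rewrite (_ : \prod_kb f kb = \prod_(k : link n T) \prod_(b : bool) f (k, b));
    last by rewrite pair_bigA; apply: eq_bigr => -[].
  under eq_bigr do rewrite big_bool.
  rewrite !big_sumType /= /f /= !prodr_const !card_ord mulr1 expr1n mulr1.
  by rewrite -exprMn mulnC exprM; congr (_ ^+ _); ring.
apply: EFin_prod_le => kb; split=> //; case: kb => -[[i|i]|t] b; rewrite /link_law /f /=.
- exact: normal_prob_itv_ge.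
- have := @normal_prob_itv_ge R _ 1 s0; rewrite !mul1r mulr1; apply.
  by rewrite ler01 lexx.
- by rewrite probability_setT.
Qed.

End Converse.

(** * Counting codewords against the widened noise *)

Section ConverseBound.
Context {R : realType} {d : measure_display} {Omega : measurableType d}.
Context (P : probability Omega R) (n T : nat).
Local Notation coords := (@coords R (link n T * bool)%type).

(** Markov's inequality for the uniform law on codewords. The factor 4 keeps a fraction above 1/2,
    which matters when there are only two codewords. *)
Lemma few_powerful_codewords (c : @code R n T) : (0 < ncodewords c)%N ->
  0 < average_power c ->
  3 / 4 * (ncodewords c)%:R <=
  #|[pred m : 'I_(ncodewords c) |
     frobenius_sq (theta c *: codeword m) <= 4 * average_power c]|%:R :> R.
Proof.
move=> M0 p0; set p := average_power c in p0 *.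
have M0' : 0 < (ncodewords c)%:R :> R by rewrite ltr0n.
set G := [pred m | _].
have sumE : (ncodewords c)%:R * p =
    \sum_(m < ncodewords c) frobenius_sq (theta c *: codeword m).
  by rewrite /p /average_power mulrA divff ?mul1r// gt_eqF.
have cardE : (ncodewords c)%:R = #|G|%:R + #|[predC G]|%:R :> R.
  by rewrite -natrD cardC card_ord.
suff : #|[predC G]|%:R * (4 * p) <= (ncodewords c)%:R * p.
  rewrite mulrCA mulrA ler_pM2r//; lra.
rewrite sumE (bigID (mem [predC G]))/=.
apply: (@le_trans _ _ (\sum_(m in [predC G]) frobenius_sq (theta c *: codeword m))).
  rewrite mulr_natl -sumr_const; apply: ler_sum => m.
  by rewrite inE /= -ltNge => /ltW.
by rewrite lerDl sumr_ge0// => m _; exact: frobenius_ge0.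
Qed.

(** On the deep fade [F], the success probabilities of the moderate codewords sum to at most
    [K * Q F], whereas [F] itself is counted for at least [3 / 4 * M] of them. The difference,
    divided by [M], is error probability. *)
Lemma error_probability_ge (ch : @channel R d Omega n) (v : R)
    (c : @code R n T) (a rho : R) :
  0 < v -> (forall i, is_CN P v (gain_g ch i)) ->
  (forall i, is_CN P v (gain_h ch i)) -> (forall t, is_CN P 1 (noise ch t)) ->
  mutually_independent P (channel_rv ch) ->
  valid_code c -> 0 < average_power c -> 0 <= a <= 1 -> 0 < rho ->
  (3 / 4 - (expR ((n%:R * a * v) ^+ 2 * (4 * average_power c) / rho) *
      Num.sqrt (1 + rho)) ^+ (T * 2) / (ncodewords c)%:R) *
    ((expR (- 2^-1) * 2 / Num.sqrt (pi *+ 2)) ^+ 2 * a) ^+ (n * 2) <=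
  error_probability P ch c.
Proof.
move=> v0 gP hP nP ind cv p0 a01 rho0.
have [a0 _] := andP a01.
have [Q [QP Qlaw]] := @channel_coords_law R d Omega P n T v ch gP hP nP ind.
set s := Num.sqrt (v / 2); set p := average_power c in p0 *.
set M := ncodewords c; have M0 : (0 < M)%N by case: cv => /ltnW.
have M0' : 0 < M%:R :> R by rewrite ltr0n.
pose s1 : R := Num.sqrt (1 / 2).
have s10 : 0 < s1 by rewrite sqrtr_gt0.
set b := (n%:R * a * v) ^+ 2 * (4 * p).
have [||Q' [Q'E Q'F]] := @product_law_shift_le R _ (@is_noise n T) s1 rho b s10 rho0
  (noise_indices n T) Q _ (uniq_noise_indices n T) _ Qlaw.
- by move=> kb; rewrite noise_indicesE.
- move=> [[k|t] b'] A; rewrite noise_indicesE => kN; last by rewrite /link_law.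
  by case/notF: kN.
rewrite size_noise_indices in Q'E.
(* Each real noise part has variance 1/2, so [s1 ^+ 2 *+ 2] is 1. *)
have -> : b / rho = b / (s1 ^+ 2 * rho *+ 2).
  by rewrite sqr_sqrtr ?divr_ge0//; field; rewrite gt_eqF.
set K := (expR _ * _) ^+ _ in Q'E *.
have K0 : 0 <= K by rewrite exprn_ge0// mulr_ge0 ?expR_ge0 ?sqrtr_ge0.
set k := _ ^+ (n * 2).
pose F : set coords := deep_fade a s.
have mF : measurable F by exact: measurable_deep_fade.
pose S m : coords -> coords := shift (noise_indices n T) (@signal_part R n T c m).
have mS m (E : set coords) : measurable E -> measurable (S m @^-1` E).
  move=> mE; rewrite -[X in measurable X]setTI.
  by apply: measurable_shift => // kb; exact: measurable_signal_part.
pose D m : set coords := @decision R n T c m.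
have mD m : measurable (D m) by exact: measurable_decision.
have FS m z : F (S m z) <-> F z.
  split; apply: deep_fade_agree => kb kbn; first exact/esym/agree_shift.
  exact: agree_shift.
have PF0 : (k%:E <= Q F)%E by exact: deep_fade_prob.
have DS m w : (S m @^-1` D m) (channel_coords ch w) =
    (decode c (channel_vector ch w) (received ch m w) = m).
  rewrite /preimage /= /D /decision /= /S -(fading_row_agree (agree_shift _ _)).
  by rewrite noise_row_shift /signal fading_row_channel noise_row_channel.
pose q m := fine (Q (S m @^-1` (F `&` D m))).
have err_ge m : fine (Q F) - q m <=
    fine (P [set w | decode c (channel_vector ch w) (received ch m w) <> m]).
  have -> : [set w | decode c (channel_vector ch w) (received ch m w) <> m] =
     channel_coords ch @^-1` (~` (S m @^-1` D m)).
    by apply/seteqP; split => w /=; rewrite -DS.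
  have mC : measurable (~` (S m @^-1` D m)) by apply: measurableC; exact: mS.
  rewrite -QP// /q lerBlDr -fineD ?fin_num_measure//; last first.
    by apply: mS; exact: measurableI.
  have mFD : measurable (S m @^-1` (F `&` D m)) by apply: mS; exact: measurableI.
  rewrite fine_le ?fin_numD ?fin_num_measure//.
  apply: (le_trans _ (measureU2 _ _ _)) => //.
  apply: le_measure; rewrite ?inE//; first exact: measurableU.
  move=> z Fz; have [Dz|Dz] := pselect ((S m @^-1` D m) z); [right|by left].
  by split => //; exact/FS.
pose G := [pred m : 'I_M | frobenius_sq (theta c *: codeword m) <= 4 * p].
have sum_q : \sum_(m in G) q m <= K * fine (Q F).
  have mFD m : measurable (F `&` D m) by exact: measurableI.
  have q_le m : m \in G -> q m <= K * fine (Q' (F `&` D m)).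
    move=> mG; rewrite -lee_fin EFinM !fineK ?fin_num_measure//; last exact: mS.
    apply: Q'E.
    - by move=> kb; exact: measurable_signal_part.
    - move=> kb z z' zz'; rewrite /signal_part /signal (fading_row_agree zz').
      exact: erefl.
    - exact: mFD.
    - by move=> z [Fz _] j _; apply: (@signal_part_le R n T c m a v) => //; exact: ltW.
  apply: (@le_trans _ _ (\sum_(m in G) K * fine (Q' (F `&` D m)))).
    exact: ler_sum.
  rewrite -mulr_sumr ler_wpM2l// -lee_fin -sumEFin.
  rewrite (eq_bigr (fun m => Q' (F `&` D m))); last first.
    by move=> m _; rewrite fineK ?fin_num_measure.
  (* The decision regions are disjoint, so their parts in [F] have total mass at most [Q' F], and
     [Q' F = Q F] because [F] ignores the noise. *)
  rewrite -measure_bigsetU_ord//; last first.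
    by move=> m m' _ _ [z [[_ zm] [_ zm']]]; rewrite -zm -zm'.
  rewrite -(Q'F F)//; last by move=> z z' zz'; exact: deep_fade_agree.
  rewrite fineK ?fin_num_measure//; apply: le_measure; rewrite ?inE//.
    exact: bigsetU_measurable.
  apply: (big_ind (fun X => X `<=` F)) => //.
  by move=> X Y XF YF; rewrite subUset.
have QFk : k <= fine (Q F) by rewrite -lee_fin fineK ?fin_num_measure.
have k0 : 0 <= k by rewrite exprn_ge0// mulr_ge0 ?sqr_ge0.
(* A negative factor makes the claim trivial; a nonnegative one allows [Q F] to be replaced by its
   lower bound [k]. *)
have [h|h] := leP 0 (3 / 4 - K / M%:R); last first.
  apply: (@le_trans _ _ 0); first by rewrite mulr_le0_ge0// ltW.
  by rewrite mulr_ge0 ?invr_ge0 ?(ltW M0')// sumr_ge0// => m _; rewrite fine_ge0.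
rewrite /error_probability -/M.
apply: (@le_trans _ _ (M%:R^-1 * \sum_(m in G) (fine (Q F) - q m))); last first.
  rewrite ler_wpM2l ?invr_ge0 ?(ltW M0')// [leRHS](bigID (mem G))/=.
  rewrite -[leLHS]addr0 lerD//; first by apply: ler_sum => m _; exact: err_ge.
  by apply: sumr_ge0 => m _; rewrite fine_ge0.
rewrite sumrB sumr_const.
have cG := few_powerful_codewords M0 p0.
rewrite -/M -/p -/G in cG.
apply: (le_trans (ler_wpM2l h QFk)).
rewrite mulrC [leRHS]mulrC ler_pdivlMr// -mulrA.
apply: (@le_trans _ _ (fine (Q F) * (3 / 4 * M%:R - K))).
  by rewrite le_eqVlt; apply/orP; left; apply/eqP; field; rewrite gt_eqF.
have QF0 : 0 <= fine (Q F) by rewrite (le_trans k0).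
rewrite mulrBr lerB//; last by rewrite mulrC.
by rewrite -[leRHS]mulr_natr ler_wpM2l.
Qed.

End ConverseBound.

(** * Minimum distance decoding at a fixed signal-to-noise ratio *)

Lemma prod_le_EFin {R : realType} (I : finType) (f : I -> R) (g : I -> \bar R) :
  (forall i, 0%E <= g i /\ (g i <= (f i)%:E)%E)%E ->
  (\big[*%E/1%E]_i g i <= (\prod_i f i)%:E)%E.
Proof.
move=> fg.
suff [] : (0%E <= \big[*%E/1%E]_i g i)%E /\
  (\big[*%E/1%E]_i g i <= (\prod_i f i)%:E)%E by [].
elim/big_ind2: _ => [|x1 x2 y1 y2 [x10 x12] [y10 y12]|i _]; last exact: fg.
- by rewrite lee01.
- by split; [exact: mule_ge0|rewrite EFinM lee_pmul].
Qed.

(** * Small products of independent Gaussian moduli *)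

Section SmallProduct.
Context {R : realType} {d : measure_display} {Omega : measurableType d}.
Context (P : probability Omega R).

Lemma union_bound (I : finType) (p : pred I) (A : I -> set Omega) (B : set Omega)
    (c : R) :
  0 <= c -> measurable B -> (forall i, measurable (A i)) ->
  (forall i, p i -> (P (A i) <= c%:E)%E) ->
  (forall w, B w -> exists2 i, p i & A i w) ->
  (P B <= (#|I|%:R * c)%:E)%E.
Proof.
move=> c0 mB mA Ac BA.
have mU (s : seq I) : measurable (\big[setU/set0]_(i <- s | p i) A i).
  exact: bigsetU_measurable.
apply: (@le_trans _ _ (P (\big[setU/set0]_(i | p i) A i))).
  apply: le_measure; rewrite ?inE// => w /BA[i pi Aiw].
  by rewrite (bigD1 i)//=; left.
have -> : #|I| = size (index_enum I) by rewrite cardT enumT [index_enum _]unlock.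
elim: (index_enum I) => [|i s IH].
  by rewrite big_nil measure0 mul0r.
rewrite big_cons; case: ifPn => pi /=; last first.
  by rewrite (le_trans IH)// lee_fin ler_wpM2r// ler_nat.
rewrite (le_trans (measureU2 _ _ _))//.
by rewrite -natr1 mulrDl mul1r addrC EFinD leeD// Ac.
Qed.

Definition disc (x : R) : set R[i] := [set z | cmod z ^+ 2 <= x].

(* [R[i]] is not a [pointedType], which [g_sigma_algebraType] requires. *)
Definition complex_space : Type := R[i].
HB.instance Definition _ := Choice.copy complex_space R[i].
HB.instance Definition _ := isPointed.Build complex_space 0.

Lemma complex_borel_disc x : complex_borel (disc x).
Proof.
pose G : set (set complex_space) := [set A | exists B : set R, measurable B /\
        (A = (@complex.Re R) @^-1` B \/ A = (@complex.Im R) @^-1` B)].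
pose T : measurableType _ := g_sigma_algebraType G.
suff : @measurable _ T (disc x) by [].
have mid : cmeasurable (id : T -> R[i]).
  move=> b _ B mB; rewrite setTI; apply: sub_sigma_algebra.
  by exists B; split => //; case: b; [right|left].
have -> : disc x = (fun z : T => cmod z ^+ 2) @^-1` `]-oo, x].
  by apply/seteqP; split => z /=; rewrite in_itv.
by rewrite -[X in measurable X]setTI; exact: (cmeasurable_normsq mid).
Qed.

(** The disc lies in a square of area [4 * x], and the density is at most [(pi * v)^-1]. The maximum
    with 1 meets the requirement [1 <= C] of [small_product_prob]. *)
Lemma CN_disc_le v (Z : Omega -> R[i]) x : 0 < v -> is_CN P v Z -> 0 <= x ->
  (P (Z @^-1` disc x) <= (Num.max 1 (4 / (pi * v)) * x)%R%:E)%E.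
Proof.
move=> v0 ZCN x0; have mZ := is_CN_cmeasurable ZCN; case: ZCN => _ ZN.
pose I : set R := `[(- Num.sqrt x), Num.sqrt x]%classic.
have mI : measurable I by exact: measurable_itv.
apply: (@le_trans _ _ (P (Z @^-1` [set z | I (complex.Re z) /\ I (complex.Im z)]))).
  apply: le_measure; rewrite ?inE//.
  - exact: cmeasurable_preimage mZ (complex_borel_disc _).
  - by apply: cmeasurable_preimage mZ _; exact: complex_borel_rect.
  move=> w /= h.
  have hb b : I (part b (Z w)).
    rewrite /I /= in_itv/= -ler_norml -sqrtr_sqr ler_wsqrtr//.
    by rewrite (le_trans (part_sq_le _ _)).
  by split; [exact: (hb false)|exact: (hb true)].
rewrite ZN//; set s := Num.sqrt (v / 2).
have s0 : 0 < s by rewrite sqrtr_gt0 divr_gt0.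
have hI := normal_prob_itv_le s0 (sqrtr_ge0 x).
apply: (le_trans (lee_pmul _ _ hI hI)) => //.
rewrite -EFinM lee_fin.
apply: (@le_trans _ _ (4 / (pi * v) * x)); last first.
  by rewrite ler_wpM2r// le_max lexx orbT.
have pk : normal_peak s ^+ 2 = (pi * v)^-1.
  rewrite /normal_peak exprVn sqr_sqrtr.
    by congr (_^-1); rewrite sqr_sqrtr ?divr_ge0 ?(ltW v0)//; field.
  by rewrite mulrn_wge0// mulr_ge0 ?sqr_ge0// pi_ge0.
rewrite -mulr_natr -[X in X * (_ * _)]mulrC.
rewrite (_ : _ * _ = (normal_peak s) ^+ 2 * (Num.sqrt x ^+ 2 * 4)); last by ring.
by rewrite pk sqr_sqrtr// le_eqVlt; apply/orP; left; apply/eqP; ring.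
Qed.

Lemma measurable_small_product (J : finType) (F : J -> Omega -> R[i]) delta :
  (forall k, cmeasurable (F k)) ->
  measurable [set w | \prod_(k : J) cmod (F k w) ^+ 2 <= delta].
Proof.
move=> mF.
have mf : measurable_fun setT (fun w => \prod_(k : J) cmod (F k w) ^+ 2).
  by apply: measurable_prod => k _; exact: cmeasurable_normsq.
rewrite (_ : [set w | _] = (fun w => \prod_(k : J) cmod (F k w) ^+ 2) @^-1`
  `]-oo, delta]).
  by rewrite -[X in measurable X]setTI; exact: mf.
by apply/seteqP; split => w /=; rewrite in_itv.
Qed.

(* Writing the threshold as [delta = delta^(1/K) ^ K], every point where the product
   is at most [delta] has integer exponents [j i <= K] of total at least [K - N] with
   [|Z i|^2 <= delta^(j i / K)]; independence bounds each of the finitely many cases. *)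
Lemma small_product_prob (I : eqType) (J : finType) (key : J -> I)
    (Z : I -> Omega -> R[i]) (C delta : R) (K : nat) :
  injective key -> mutually_independent P Z ->
  (forall k, cmeasurable (Z (key k))) ->
  (forall k x, 0 <= x -> (P (Z (key k) @^-1` disc x) <= (C * x)%:E)%E) ->
  1 <= C -> 0 < delta <= 1 -> (0 < K)%N -> (0 < #|J|)%N ->
  (P [set w | (\prod_(k : J) cmod (Z (key k) w) ^+ 2 <= delta)%R] <=
    (K.+1%:R ^+ #|J| * C ^+ #|J| * delta `^ (1 - #|J|%:R / K%:R))%:E)%E.
Proof.
move=> key_inj ind mZ Zle C1 /andP[d0 d1] K0 J0.
set N := #|J| in J0 *.
have K0' : 0 < K%:R :> R by rewrite ltr0n.
pose th (j : nat) : R := delta `^ (j%:R / K%:R).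
have th_gt0 j : 0 < th j by rewrite powR_gt0.
(* Exponent 0 imposes no condition: its threshold is 1, and [C >= 1] makes the bound [C * th 0]
   valid for the whole space. *)
pose B (j : nat) : set R[i] := if j is 0 then setT else disc (th j).
have mB j : complex_borel (B j).
  case: j => [|j]; last exact: complex_borel_disc.
  have := @complex_borel_rect R setT setT measurableT measurableT.
  by rewrite (_ : [set z | _] = setT)//; apply/seteqP; split.
pose E (j : {ffun J -> 'I_K.+1}) : set Omega :=
  \bigcap_(k in [set: J]) (Z (key k) @^-1` B (j k)).
have mE j : measurable (E j).
  by apply: fin_bigcap_measurable => // k _; exact: cmeasurable_preimage.
pose big (j : {ffun J -> 'I_K.+1}) := (K <= \sum_k (j k).+1)%N.
have th_prod (j : J -> nat) : \prod_k th (j k) = th (\sum_k j k)%N.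
  elim/big_rec2: _ => [|k m p _ ->]; first by rewrite /th mul0r powRr0.
  rewrite /th natrD mulrDl powRD//.
  by apply/implyP => _; rewrite gt_eqF.
have th_anti i j : (i <= j)%N -> th j <= th i.
  move=> ij; apply: ger_powR; first by rewrite d0 d1.
  by rewrite ler_pM2r ?invr_gt0// ler_nat.
have PE j : big j -> (P (E j) <= (C ^+ N * delta `^ (1 - N%:R / K%:R))%:E)%E.
  move=> jK.
  pose A (i : I) : set R[i] :=
    if [pick k | key k == i] is Some k then B (j k) else setT.
  have Akey k : A (key k) = B (j k).
    rewrite /A; case: pickP => [k' /eqP/key_inj ->//|/(_ k)].
    by rewrite eqxx.
  have mA i : complex_borel (A i).
    by rewrite /A; case: pickP => [k _|_]; [exact: mB|exact: (mB 0%N)].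
  have := ind [seq key k | k <- enum J] A.
  rewrite map_inj_uniq// enum_uniq => /(_ isT mA) H.
  have EA : E j = \bigcap_(i in [set` [seq key k | k <- enum J]]) (Z i @^-1` A i).
    apply/seteqP; split => w /= Ew.
      by move=> _ /mapP[k _ ->]; rewrite Akey; exact: Ew.
    by move=> k _; rewrite /= -Akey; apply: Ew => /=; rewrite map_f ?mem_enum.
  rewrite EA H big_map big_enum /=.
  apply: (@le_trans _ _ (\prod_(k : J) (C * th (j k)))%:E).
    apply: prod_le_EFin => k; split => //; rewrite Akey.
    case: (nat_of_ord (j k)) => [|i] /=; last by apply: Zle; exact: ltW.
    rewrite preimage_setT probability_setT lee_fin /th mul0r powRr0.
    by rewrite mulr1.
  rewrite lee_fin big_split /= prodr_const th_prod.
  rewrite ler_wpM2l ?exprn_ge0 ?(le_trans ler01)//.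
  apply: ger_powR; first by rewrite d0 d1.
  rewrite lerBlDr -mulrDl ler_pdivlMr// mul1r -natrD ler_nat.
  rewrite (leq_trans jK)// -[X in (_ + X)%N]sum1_card -big_split /=.
  by apply: leq_sum => k _; rewrite addn1.
have cover : [set w | \prod_(k : J) cmod (Z (key k) w) ^+ 2 <= delta] `<=`
    \bigcup_(j in [set j | big j]) E j.
  move=> w /= wd.
  pose ok k (i : 'I_K.+1) := (i == 0 :> nat) || (cmod (Z (key k) w) ^+ 2 <= th i).
  pose j k := [arg max_(i > ord0 | ok k i) i].
  have jP k : ok k (j k) /\ forall i, ok k i -> (i <= j k)%N.
    by rewrite /j; case: arg_maxnP => // i oki imax; split.
  exists [ffun k => j k]; last first.
    move=> k _; rewrite /= ffunE; have [+ _] := jP k; rewrite /ok /B.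
    by case: (nat_of_ord (j k)).
  rewrite /= /big leqNgt; apply/negP => small.
  (* A total below [K] keeps each [j k] below [K], so its successor is still an admissible exponent.
     By maximality it fails, which gives [|Z|^2 > th (j k).+1]. *)
  have jlt k : (j k < K)%N.
    move: small; rewrite (bigD1 k)//= ffunE; apply: leq_ltn_trans.
    exact: leq_trans (leqnSn _) (leq_addr _ _).
  have : delta < \prod_(k : J) cmod (Z (key k) w) ^+ 2; last by rewrite ltNge wd.
  apply: (@le_lt_trans _ _ (\prod_k th (j k).+1)).
    rewrite th_prod -[leLHS](powRr1 (ltW d0)); apply: ger_powR.
      by rewrite d0 d1.
    rewrite ler_pdivrMr// mul1r ler_nat ltnW//.
    by move: small; under eq_bigr do rewrite ffunE.
  have [k0 _] : exists k0 : J, k0 \in J by move/card_gt0P: J0.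
  apply: ltr_prod; first by apply/hasP; exists k0; rewrite ?mem_index_enum.
  move=> k _; rewrite (ltW (th_gt0 _)) /= ltNge; apply/negP => h.
  have [_ /(_ (Ordinal (jlt k : (j k).+1 < K.+1)%N))] := jP k.
  by rewrite /ok /= h ltnn => /(_ isT).
have mprod := measurable_small_product delta mZ.
have := @union_bound _ big E _ (C ^+ N * delta `^ (1 - N%:R / K%:R)) _ mprod mE PE.
rewrite card_ffun card_ord natrX mulrA; apply; last first.
  by move=> w /cover [j bj Ej]; exists j.
by rewrite mulr_ge0 ?powR_ge0// exprn_ge0// (le_trans ler01).
Qed.

End SmallProduct.

(** * The diagonal code and its decoder *)

Section MinimumDistanceCode.
Context {R : realType} (n q : nat) (x : 'I_q.+2 -> 'I_(n + n) -> R) (snr : R).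

Definition symbol m (t : 'I_n) : R[i] :=
  Complex (x m (lshift n t)) (x m (rshift n t)).

Definition diag_codeword m : 'M[R[i]]_(n, n) := diag_mx (\row_t symbol m t).

Definition amplitude : R[i] := Complex (Num.sqrt snr) 0.

Definition residual (m : 'I_q.+2) (H y : 'rV[R[i]]_n) : R :=
  frobenius_sq (y - amplitude *: (H *m diag_codeword m)).

(** [pick] fixes the tie-breaking. The default [ord0] is never reached, since finitely many
    residuals have a minimum. *)
Definition nearest (H y : 'rV[R[i]]_n) : 'I_q.+2 :=
  odflt ord0 [pick m | [forall m', residual m H y <= residual m' H y]].

Definition nearest_code : code n n := Code diag_codeword amplitude nearest.

Lemma nearest_le H y m : residual (nearest H y) H y <= residual m H y.
Proof.
rewrite /nearest; case: pickP => [m0 /forallP/(_ m)//|no].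
have [m0 _ m0min] := @arg_minP _ _ _ ord0 xpredT (fun m => residual m H y) isT.
by have /negP[] := no m0; apply/forallP => m'; exact: m0min.
Qed.

Definition observation : Type := ('rV[R[i]]_n * 'rV[R[i]]_n)%type.
HB.instance Definition _ := Choice.copy observation ('rV[R[i]]_n * 'rV[R[i]]_n)%type.
HB.instance Definition _ := isPointed.Build observation (0, 0).

(** The decision is a function of the finitely many truth values of the comparisons between
    residuals, each of which is measurable. *)
Lemma coordinate_borel_nearest m :
  coordinate_borel (@coordinate R n n) [set z | nearest z.1 z.2 = m].
Proof.
pose G : set (set observation) := [set A | exists k (B : set R[i]),
  complex_borel B /\ A = (coordinate k) @^-1` B].
pose T : measurableType _ := g_sigma_algebraType G.
suff : @measurable _ T [set z | nearest z.1 z.2 = m] by [].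
have mco k : cmeasurable (fun z : T => coordinate k z).
  move=> b _ B mB; rewrite setTI; apply: (@sub_sigma_algebra _ setT G).
  exists k, (part b @^-1` B); split => //.
  suff : complex_borel (part b @^-1` B) by [].
  apply: sub_sigma_algebra.
  by exists B; split => //; case: b; [right|left].
have mres m' : measurable_fun setT (fun z : T => residual m' z.1 z.2).
  rewrite (_ : (fun _ => _) = (fun z : T => \sum_(t < n) cmod (coordinate (inr t) z +
    - (amplitude * (\sum_i coordinate (inl i) z * diag_codeword m' i t))) ^+ 2)).
    apply: measurable_sum => t; apply: cmeasurable_normsq.
    apply: cmeasurableD => //; apply: cmeasurableN; apply: cmeasurableM.
      exact: cmeasurable_cst.
    apply: cmeasurable_sum => i; apply: cmeasurableM => //.
  apply/funext => z; rewrite /residual /frobenius_sq big_ord1.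
  by apply: eq_bigr => t _; rewrite !mxE.
pose le (z : T) : {ffun 'I_q.+2 * 'I_q.+2 -> bool} :=
  [ffun mm => residual mm.1 z.1 z.2 <= residual mm.2 z.1 z.2].
pose dec (b : {ffun 'I_q.+2 * 'I_q.+2 -> bool}) : 'I_q.+2 :=
  odflt ord0 [pick m | [forall m', b (m, m')]].
have -> : [set z | nearest z.1 z.2 = m] =
    \bigcup_(b in [set b | dec b = m])
      \bigcap_(mm in [set: 'I_q.+2 * 'I_q.+2]) [set z : T | le z mm = b mm].
  have decE z : dec (le z) = nearest z.1 z.2.
    rewrite /dec /nearest; congr (odflt _ _); apply: eq_pick => m'.
    by apply: eq_forallb => m''; rewrite ffunE.
  apply/seteqP; split => z /=.
    by move=> zm; exists (le z); rewrite /= ?decE.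
  move=> [b <-] zb; rewrite -decE; congr dec; apply/ffunP => mm.
  exact: zb.
apply: fin_bigcup_measurable => // b _; apply: fin_bigcap_measurable => // mm _.
have mle : measurable_fun setT (fun z : T => residual mm.1 z.1 z.2 <= residual mm.2 z.1 z.2).
  exact: measurable_fun_ler.
rewrite (_ : [set z | _] = (fun z : T => residual mm.1 z.1 z.2 <= residual mm.2 z.1 z.2)
  @^-1` [set b mm]).
  by rewrite -[X in measurable X]setTI; exact: mle.
by apply/seteqP; split => z /=; rewrite ffunE.
Qed.

Hypothesis xne : forall m m', m != m' -> 0 < \prod_t `|x m t - x m' t|.

Lemma nearest_code_valid : (0 < n)%N -> valid_code nearest_code.
Proof.
move=> n0; split => //; last exact: coordinate_borel_nearest.
move=> m m' /= mm'; apply/eqP; apply: contraT => /xne.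
pose t := Ordinal n0.
have := congr1 (fun A : 'M[R[i]]_n => A t t) mm'.
rewrite !mxE eqxx !mulr1n => -[xt _].
by rewrite (bigD1 (lshift n t))//= xt subrr normr0 mul0r ltxx.
Qed.

Hypothesis x12 : forall m t, 1 <= x m t <= 2.
Hypothesis snr0 : 0 < snr.

Lemma cmod_amplitude : cmod amplitude ^+ 2 = snr.
Proof.
by rewrite cmod_sqE /= expr0n/= addr0 sqr_sqrtr// ltW.
Qed.

Lemma nearest_code_power :
  snr * n%:R * 2 <= average_power nearest_code <= snr * n%:R * 8.
Proof.
have pE m : frobenius_sq (amplitude *: diag_codeword m) =
    \sum_t snr * (x m (lshift n t) ^+ 2 + x m (rshift n t) ^+ 2).
  rewrite /frobenius_sq; apply: eq_bigr => t _.
  rewrite (bigD1 t)//= big1 ?addr0.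
    rewrite !mxE eqxx mulr1n cmodM exprMn cmod_amplitude; congr (_ * _).
    by rewrite cmod_sqE.
  move=> t' tt'; rewrite !mxE eq_sym (negbTE tt') mulr0n mulr0.
  by rewrite ComplexField.Normc.normc0 expr0n.
have M0 : 0 < q.+2%:R :> R by [].
have xb m t : 1 <= x m t ^+ 2 <= 4.
  have /andP[x1 x2] := x12 m t; apply/andP; split; nra.
have pb m : snr * n%:R * 2 <= frobenius_sq (amplitude *: diag_codeword m) <= snr * n%:R * 8.
  rewrite pE; apply/andP; split.
    rewrite (_ : snr * _ * _ = \sum_(t < n) snr * 2); last first.
      by rewrite sumr_const card_ord -mulr_natl; ring.
    apply: ler_sum => t _; rewrite ler_wpM2l ?(ltW snr0)//.
    by have /andP[+ _] := xb m (lshift n t); have /andP[+ _] := xb m (rshift n t); lra.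
  rewrite (_ : snr * _ * _ = \sum_(t < n) snr * 8); last first.
    by rewrite sumr_const card_ord -mulr_natl; ring.
  apply: ler_sum => t _; rewrite ler_wpM2l ?(ltW snr0)//.
  by have /andP[_ +] := xb m (lshift n t); have /andP[_ +] := xb m (rshift n t); lra.
rewrite /average_power /= ler_pdivlMl// ler_pdivrMl//.
have cst (c : R) : q.+2%:R * c = \sum_(m < q.+2) c.
  by rewrite sumr_const card_ord mulr_natl.
rewrite !cst; apply/andP; split; apply: ler_sum => m _.
  by have /andP[] := pb m.
by have /andP[] := pb m.
Qed.

End MinimumDistanceCode.

Section NearestError.
Context {R : realType} {d : measure_display} {Omega : measurableType d}.
Context (P : probability Omega R).
Context (n q : nat) (x : 'I_q.+2 -> 'I_(n + n) -> R) (snr kappa : R).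
Hypothesis snr0 : 0 < snr.
Hypothesis kappa0 : 0 < kappa.
Hypothesis xdist : forall m m', m != m' -> kappa^-1 <= \prod_t `|x m t - x m' t|.

Lemma xdist_gt0 m m' : m != m' -> 0 < \prod_t `|x m t - x m' t|.
Proof. by move=> /xdist; apply: lt_le_trans; rewrite invr_gt0. Qed.

Lemma cmodB_sq_le (a b : R[i]) :
  cmod (a - b) ^+ 2 <= 2 * cmod a ^+ 2 + 2 * cmod b ^+ 2.
Proof.
rewrite !cmod_sqE; case: a b => [a1 a2] [b1 b2] /=.
rewrite -subr_ge0 (_ : _ - _ = (a1 + b1) ^+ 2 + (a2 + b2) ^+ 2); last by ring.
by rewrite addr_ge0// sqr_ge0.
Qed.

Lemma diag_codeword_entry (H : 'rV[R[i]]_n) m t :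
  (H *m diag_codeword x m) 0 t = H 0 t * symbol x m t.
Proof.
rewrite mxE (bigD1 t)//= big1 ?addr0; first by rewrite !mxE eqxx mulr1n.
by move=> i it; rewrite !mxE (negbTE it) mulr0n mulr0.
Qed.

(** The conclusion does not mention the codeword decoded by mistake. Both the true and the chosen
    residual are at most [tau], so each entry of the difference of the two noiseless outputs has
    squared modulus at most [4 * tau]. *)
Lemma nearest_error_fading (H W : 'rV[R[i]]_n) m tau :
  frobenius_sq W <= tau ->
  nearest x snr H (amplitude snr *: (H *m diag_codeword x m) + W) <> m ->
  \prod_t cmod (H 0 t) ^+ 2 <= (4 * tau / snr) ^+ n * kappa.
Proof.
move=> Wtau; set y := _ + W; set m' := nearest _ _ _ _ => mm'.
have tau0 : 0 <= tau by rewrite (le_trans _ Wtau)// frobenius_ge0.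
have : residual x snr m' H y <= residual x snr m H y by exact: nearest_le.
have -> : residual x snr m H y = frobenius_sq W.
  by rewrite /residual /y addrC addKr.
set V := y - amplitude snr *: (H *m diag_codeword x m') => Vres.
have {}Vres : frobenius_sq V <= frobenius_sq W by [].
have Ut t : snr * cmod (H 0 t) ^+ 2 * cmod (symbol x m t - symbol x m' t) ^+ 2
    <= 4 * tau.
  rewrite -(cmod_amplitude snr0) -!exprMn -!cmodM.
  have -> : amplitude snr * H 0 t * (symbol x m t - symbol x m' t) = V 0 t - W 0 t.
    have Ve k : (amplitude snr *: (H *m diag_codeword x k)) 0 t =
        amplitude snr * (H 0 t * symbol x k t).
      by rewrite mxE diag_codeword_entry.
    have -> : V 0 t = (amplitude snr *: (H *m diag_codeword x m)) 0 t + W 0 t -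
        (amplitude snr *: (H *m diag_codeword x m')) 0 t.
      by rewrite /V /y mxE [X in X + _]mxE [X in _ + X]mxE.
    by rewrite !Ve; ring.
  apply: (le_trans (cmodB_sq_le _ _)).
  have entry (A : 'rV[R[i]]_n) : cmod (A 0 t) ^+ 2 <= frobenius_sq A.
    rewrite /frobenius_sq big_ord1 (bigD1 t)//= lerDl.
    by apply: sumr_ge0 => i _; exact: sqr_ge0.
  have := entry V; have := entry W; lra.
(* Replacing [u^2 + v^2] by [|u| * |v|] turns the product over complex symbols into the product over
   all [n + n] real coordinates. *)
have : \prod_(t < n) (snr * cmod (H 0 t) ^+ 2 *
    (`|x m (lshift n t) - x m' (lshift n t)| *
     `|x m (rshift n t) - x m' (rshift n t)|)) <= \prod_(t < n) (4 * tau).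
  apply: ler_prod => t _.
  have h0 : 0 <= snr * cmod (H 0 t) ^+ 2 by rewrite pmulr_rge0// sqr_ge0.
  apply/andP; split; first by rewrite mulr_ge0// mulr_ge0.
  apply: le_trans (Ut t); rewrite ler_wpM2l//.
  rewrite cmod_sqE /=; set u := x _ _ - _; set v := x _ _ - _.
  rewrite -(real_normK (num_real u)) -(real_normK (num_real v)).
  have := sqr_ge0 (`|u| - `|v|); have := normr_ge0 u; have := normr_ge0 v; nra.
rewrite big_split [X in X * _ <= _]big_split [X in _ * X <= _]big_split /=.
rewrite !prodr_const card_ord.
have mm : m != m' by apply/eqP => h; exact: mm'.
have := xdist mm; rewrite big_split_ord /=.
set Du := \prod_(i < n) _; set Dv := \prod_(i < n) _; set Ph := \prod_(i < n) _.
have Ph0 : 0 <= Ph by apply: prodr_ge0 => t _; rewrite sqr_ge0.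
move=> hD hP; rewrite expr_div_n mulrAC ler_pdivlMr ?exprn_gt0//.
have k1 : 1 <= kappa * (Du * Dv) by rewrite -ler_pdivrMl// mulr1.
have sn : 0 < snr ^+ n by rewrite exprn_gt0.
apply: (@le_trans _ _ (snr ^+ n * Ph * (kappa * (Du * Dv)))).
  by rewrite mulrC ler_peMr// mulr_ge0// ltW.
by rewrite mulrCA mulrC ler_wpM2r// ltW.
Qed.

Lemma CN_tail_le (Z : Omega -> R[i]) b a : is_CN P 1 Z -> 0 <= a ->
  (P [set w | (a < `|part b (Z w)|)%R] <=
   (expR (- a ^+ 2 / 2) * Num.sqrt 2)%R%:E)%E.
Proof.
move=> [_ ZN] a0; set s := Num.sqrt (1 / 2) in ZN.
have s0 : 0 < s by rewrite sqrtr_gt0.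
have := normal_prob_tail_le s0 a0.
set A := [set y : R | _] => hA.
have mA : measurable A by exact: measurable_norm_gt.
suff -> : P [set w | a < `|part b (Z w)|] = normal_prob 0 s A.
  apply: (le_trans hA); rewrite lee_fin sqr_sqrtr// -mulr_natr.
  by rewrite (_ : 1 / 2 * 4 = 2)//; field.
case: b.
  have := ZN setT A measurableT mA; rewrite probability_setT mul1e => <-.
  by congr (P _); apply/seteqP; split => w /=; [split|case].
have := ZN A setT mA measurableT; rewrite probability_setT mule1 => <-.
by congr (P _); apply/seteqP; split => w /=; [split|case].
Qed.

(** Errors are covered by a small fading product [A1] and a large real noise part [A2]. Neither
    depends on the message, so averaging over messages costs nothing. *)
Lemma nearest_error_probability_le (ch : @channel R d Omega n) v a (K : nat) :
  (0 < n)%N -> 0 < v -> (forall i, is_CN P v (gain_g ch i)) ->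
  (forall i, is_CN P v (gain_h ch i)) -> (forall t, is_CN P 1 (noise ch t)) ->
  mutually_independent P (channel_rv ch) ->
  0 < a -> (0 < K)%N ->
  (8 * n%:R * a ^+ 2 / snr) ^+ n * kappa <= 1 ->
  error_probability P ch (nearest_code x snr) <=
  K.+1%:R ^+ (n + n) * Num.max 1 (4 / (pi * v)) ^+ (n + n) *
    ((8 * n%:R * a ^+ 2 / snr) ^+ n * kappa) `^ (1 - (n + n)%:R / K%:R) +
  (n * 2)%:R * (expR (- a ^+ 2 / 2) * Num.sqrt 2).
Proof.
move=> n0 v0 gP hP nP ind a0 K0; set delta := _ * kappa => d1.
set C := Num.max _ _.
have n0' : 0 < n%:R :> R by rewrite ltr0n.
have d0 : 0 < delta.
  by rewrite mulr_gt0// exprn_gt0// divr_gt0// !mulr_gt0// exprn_gt0.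
pose key (k : 'I_n + 'I_n) : 'I_n + 'I_n + nat := inl k.
have mlink k : cmeasurable (channel_rv ch k).
  exact: (channel_rv_cmeasurable gP hP nP).
have fade_le := @small_product_prob R d Omega P _ ('I_n + 'I_n)%type key
  (channel_rv ch) C delta K.
rewrite card_sum card_ord in fade_le.
pose A1 := [set w | \prod_k cmod (channel_rv ch (key k) w) ^+ 2 <= delta].
pose A2 := [set w | exists tb : 'I_n * bool, a < `|part tb.2 (noise ch tb.1 w)|].
have PA1 : (P A1 <= (K.+1%:R ^+ (n + n) * C ^+ (n + n) *
    delta `^ (1 - (n + n)%:R / K%:R))%:E)%E.
  apply: fade_le => //.
  - by move=> k k' [].
  - by case=> i y y0 /=; exact: CN_disc_le.
  - by rewrite /C le_max lexx.
  - by rewrite d0.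
  - by rewrite addn_gt0 n0.
have mnoise b t : measurable_fun setT (fun w => part b (noise ch t w)).
  exact: (is_CN_cmeasurable (nP t)).
have mtail tb : measurable [set w | a < `|part tb.2 (noise ch tb.1 w)|].
  rewrite -[X in measurable X]setTI.
  exact: (mnoise tb.2 tb.1 measurableT _ (measurable_norm_gt a)).
have mA2 : measurable A2.
  have -> : A2 = \bigcup_(tb in [set: 'I_n * bool])
      [set w | a < `|part tb.2 (noise ch tb.1 w)|].
    by apply/seteqP; split => w /= [tb]; [exists tb|move=> _; exists tb].
  by apply: fin_bigcup_measurable => // tb _; exact: (mtail (nat_of_ord tb.1, tb.2)).
have PA2 : (P A2 <= ((n * 2)%:R * (expR (- a ^+ 2 / 2) * Num.sqrt 2))%:E)%E.
  have := @union_bound _ _ _ P ('I_n * bool)%type xpredT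
    (fun tb => [set w | a < `|part tb.2 (noise ch tb.1 w)|]) A2
    (expR (- a ^+ 2 / 2) * Num.sqrt 2).
  rewrite card_prod card_ord card_bool; apply => //.
  - by move=> tb; exact: (mtail (nat_of_ord tb.1, tb.2)).
  - by move=> tb _; apply: CN_tail_le => //; exact: ltW.
  - by move=> w [tb]; exists tb.
have mA1 : measurable A1 by by apply: measurable_small_product => k; exact: mlink.
have err_le m : fine (P [set w | decode (nearest_code x snr) (channel_vector ch w)
    (received (c := nearest_code x snr) ch m w) <> m]) <=
   K.+1%:R ^+ (n + n) * C ^+ (n + n) * delta `^ (1 - (n + n)%:R / K%:R) +
   (n * 2)%:R * (expR (- a ^+ 2 / 2) * Num.sqrt 2).
  set E := [set w | _].
  have mE : measurable E.
    apply: measurable_decode_error; last exact: (nearest_code_valid snr xdist_gt0).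
    exact: mlink.
  rewrite -lee_fin fineK ?fin_num_measure// EFinD.
  apply: (@le_trans _ _ (P A1 + P A2)%E); last exact: leeD.
  apply: (@le_trans _ _ (P (A1 `|` A2))); last exact: measureU2.
  apply: le_measure; rewrite ?inE//; first exact: measurableU.
  move=> w Ew; have [|nA2] := pselect (A2 w); [by right|left].
  rewrite /A1 /= big_sumType /= -big_split /=.
  (* Outside [A2] each of the [n] complex samples has squared modulus at most [2 * a ^+ 2], whence
     the [8 * n * a ^+ 2] in [delta]. *)
  have Wtau : frobenius_sq (noise_vector ch n w) <= n%:R * (2 * a ^+ 2).
    rewrite /frobenius_sq big_ord1 mulr_natl -[X in _ *+ X](card_ord n) -sumr_const.
    apply: ler_sum => t _; rewrite mxE.
    have hb b : part b (noise ch t w) ^+ 2 <= a ^+ 2.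
      rewrite -[leLHS]real_normK ?num_real// lerXn2r ?nnegrE ?(ltW a0)//.
      by rewrite leNgt; apply/negP => h; apply: nA2; exists (t, b).
    by rewrite cmod_sqE; have := hb false; have := hb true; lra.
  have := nearest_error_fading Wtau Ew.
  rewrite (_ : 4 * (n%:R * (2 * a ^+ 2)) = 8 * n%:R * a ^+ 2); last by ring.
  apply: le_trans; rewrite le_eqVlt; apply/orP; left; apply/eqP.
  by apply: eq_bigr => i _; rewrite mxE cmodM exprMn.
rewrite /error_probability /= ler_pdivrMl//.
rewrite [leRHS]mulr_natl -[X in _ *+ X](card_ord q.+2) -sumr_const.
by apply: ler_sum => m _; exact: err_le.
Qed.

End NearestError.

(** * Asymptotics *)

Section PowerOrder.
Context {R : realType}.
Implicit Types (x y c e : R) (f : R -> R).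

Lemma near_ge c : \forall x \near (+oo : set_system R), c <= x.
Proof. by apply: nbhs_pinfty_ge; rewrite num_real. Qed.

Lemma near_gt c : \forall x \near (+oo : set_system R), c < x.
Proof. by apply: nbhs_pinfty_gt; rewrite num_real. Qed.

Lemma lne_ratioE x y : 1 < x -> 0 < y ->
  (lne y%:E / (ln x)%:E)%E = (ln y / ln x)%:E.
Proof.
move=> x1 y0; have lx : 0 < ln x by rewrite ln_gt0.
by rewrite lne_EFin// inver gt_eqF.
Qed.

(** Nonpositive [y] is included: the left side is then [-oo] and the right side holds because powers
    are nonnegative. Thus [doteq] becomes a pair of power bounds. *)
Lemma lne_ratio_le x y c : 1 < x ->
  (lne y%:E / (ln x)%:E <= c%:E)%E = (y <= x `^ c).
Proof.
move=> x1; have lx : 0 < ln x by rewrite ln_gt0.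
have x0 : 0 < x by rewrite (lt_trans ltr01).
have [y0|y0] := leP y 0.
  rewrite le0_lneNy ?lee_fin// inver gt_eqF// mulNyr gtr0_sg ?invr_gt0// mul1e leNye.
  by rewrite (le_trans y0)// powR_ge0.
rewrite lne_ratioE// lee_fin ler_pdivrMr// -ln_powR ler_ln ?posrE//.
by rewrite powR_gt0.
Qed.

Lemma lne_ratio_ge x y c : 1 < x ->
  (c%:E <= lne y%:E / (ln x)%:E)%E = (x `^ c <= y).
Proof.
move=> x1; have lx : 0 < ln x by rewrite ln_gt0.
have x0 : 0 < x by rewrite (lt_trans ltr01).
have [y0|y0] := leP y 0.
  rewrite le0_lneNy ?lee_fin// inver gt_eqF// mulNyr gtr0_sg ?invr_gt0// mul1e.
  rewrite leeNy_eq/=; apply/esym/negbTE.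
  by rewrite -ltNge (le_lt_trans y0)// powR_gt0.
rewrite lne_ratioE// lee_fin ler_pdivlMr// -ln_powR ler_ln ?posrE//.
by rewrite powR_gt0.
Qed.

Lemma doteq_bounds f b e : doteq f b%:E -> 0 < e ->
  \forall x \near +oo, x `^ (b - e) <= f x <= x `^ (b + e).
Proof.
move=> /fine_cvgP[fin /cvgrPdist_le cvgf] e0.
have cvge := cvgf _ e0; near=> x.
have x1 : 1 < x by near: x; exact: near_gt.
rewrite -lne_ratio_le// -lne_ratio_ge//.
have <- : ((fine (lne (f x)%:E / (ln x)%:E))%:E = lne (f x)%:E / (ln x)%:E)%E.
  by rewrite fineK//; near: x; exact: fin.
rewrite !lee_fin.
have : `|b - fine (lne (f x)%:E / (ln x)%:E)%E| <= e by near: x; exact: cvge.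
by rewrite ler_norml => /andP[h1 h2]; apply/andP; split; lra.
Unshelve. all: by end_near. Qed.

Lemma doteqP f b :
  (forall e, 0 < e -> \forall x \near +oo, x `^ (b - e) <= f x <= x `^ (b + e)) ->
  doteq f b%:E.
Proof.
move=> fb; apply/fine_cvgP.
have bnd e : 0 < e -> \forall x \near +oo,
    ((b - e)%:E <= lne (f x)%:E / (ln x)%:E)%E /\
    (lne (f x)%:E / (ln x)%:E <= (b + e)%:E)%E.
  move=> e0; have fbe := fb _ e0; near=> x.
  have x1 : 1 < x by near: x; exact: near_gt.
  rewrite lne_ratio_le// lne_ratio_ge//; apply/andP; near: x; exact: fbe.
split.
  have := bnd 1 ltr01; near_simpl; apply: filterS => x [h1 h2].
  by rewrite fin_numElt (lt_le_trans _ h1) ?ltNyr// (le_lt_trans h2) ?ltry.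
apply/cvgrPdist_le => e e0; have := bnd e e0; near_simpl; apply: filterS => x [h1 h2].
have fin : (lne (f x)%:E / (ln x)%:E)%E \is a fin_num.
  by rewrite fin_numElt (lt_le_trans _ h1) ?ltNyr// (le_lt_trans h2) ?ltry.
rewrite /=; move: h1 h2; rewrite -(fineK fin) !lee_fin /= => h1 h2.
by rewrite ler_norml; apply/andP; split; lra.
Unshelve. all: by end_near. Qed.

(** Here [l] may be infinite, as the converse must handle every extended diversity gain. *)
Lemma doteq_ge f b (l : \bar R) : doteq f l ->
  (forall e, 0 < e -> \forall x \near +oo, x `^ (b - e) <= f x) -> (b%:E <= l)%E.
Proof.
move=> fl fb; apply/lee_subgt0Pr => e e0.
rewrite -EFinB; apply: cvge_ge fl.
have fbe := fb _ e0; near=> x.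
have x1 : 1 < x by near: x; exact: near_gt.
by rewrite lne_ratio_ge//; near: x; exact: fbe.
Unshelve. all: by end_near. Qed.

Lemma near_powRN_le c e : 0 < c -> 0 < e -> \forall x \near +oo, x `^ (- c) <= e.
Proof.
move=> c0 e0; near=> x.
have x1 : 1 < x by near: x; exact: near_gt.
have x0 : 0 < x by rewrite (lt_trans ltr01).
have ex : e^-1 `^ c^-1 <= x by near: x; exact: near_ge.
rewrite powRN invf_ple ?posrE ?powR_gt0//.
rewrite -[leLHS]powRr1 ?invr_ge0 ?(ltW e0)// -(mulVf (lt0r_neq0 c0)) powRrM.
by apply: ge0_ler_powR; rewrite ?nnegrE ?powR_ge0// ltW.
Unshelve. all: by end_near. Qed.

Lemma near_powR_ge c K : 0 < c -> \forall x \near +oo, K <= x `^ c.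
Proof.
move=> c0; pose K1 := Num.max K 1.
have K10 : 0 < K1 by rewrite lt_max ltr01 orbT.
have K1V : 0 < K1^-1 by rewrite invr_gt0.
near=> x.
have x0 : 0 < x by near: x; exact: near_gt.
have : x `^ (- c) <= K1^-1 by near: x; exact: near_powRN_le.
rewrite powRN lef_pV2 ?posrE//; last by rewrite powR_gt0.
by apply: le_trans; rewrite le_max lexx.
Unshelve. all: by end_near. Qed.

(** With [y = x^(e/2)], one factor [y] absorbs [ln y] and the other the constant. *)
Lemma near_ln_le c e : 0 < e -> \forall x \near +oo, c * ln x <= x `^ e.
Proof.
move=> e0; have e20 : 0 < e / 2 by rewrite divr_gt0.
near=> x.
have x1 : 1 < x by near: x; exact: near_gt.
have x0 : 0 < x by rewrite (lt_trans ltr01).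
pose y := x `^ (e / 2).
have y0 : 0 < y by rewrite powR_gt0.
have -> : x `^ e = y * y.
  rewrite -powRD; last by apply/implyP => _; rewrite gt_eqF.
  by rewrite -splitr.
have cy : `|c| / (e / 2) <= x `^ (e / 2) by near: x; exact: near_powR_ge.
have lny : ln y <= y by rewrite ltW// ln_sublinear.
have -> : ln x = ln y / (e / 2) by rewrite /y ln_powR mulrAC divff ?mul1r// gt_eqF.
have h1 : 0 <= ln y.
  by rewrite /y ln_powR mulr_ge0// ltW// ln_gt0.
apply: (@le_trans _ _ (`|c| / (e / 2) * ln y)); last by apply: ler_pM => //; rewrite divr_ge0// ltW.
have -> : `|c| / (e / 2) * ln y = `|c| * (ln y / (e / 2)) by rewrite mulrAC mulrA.
by rewrite ler_wpM2r ?ler_norm// divr_ge0// ltW.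
Unshelve. all: by end_near. Qed.

End PowerOrder.

(** * Exponent of the converse *)

Section ConverseAsymptotics.
Context {R : realType} {d : measure_display} {Omega : measurableType d}.
Context (P : probability Omega R) (n : nat).

Lemma rate_ratioE (x : R) T (c : @code R n T) :
  rate c / log2 x = ln (ncodewords c)%:R / T%:R / ln x.
Proof.
rewrite /rate /log2 invfM invrK.
have l2 : ln 2 != 0 :> R by rewrite gt_eqF// ln_gt0// ltr1n.
by move: (T%:R^-1) ((ln x)^-1) => t y; field.
Qed.

Lemma gain_ncodewords_ge T (C : R -> @code R n T) (r w : R) :
  (0 < T)%N -> 0 < w -> (forall x, 0 < x -> (1 < ncodewords (C x))%N) ->
  multiplexing_gain C r ->
  \forall x \near +oo, x `^ (T%:R * (r - w)) <= (ncodewords (C x))%:R.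
Proof.
move=> T0 w0 M1 /cvgrPdist_le /(_ _ w0) rr; near=> x.
have x1 : 1 < x by near: x; exact: near_gt.
have x0 : 0 < x by rewrite (lt_trans ltr01).
have lx : 0 < ln x by rewrite ln_gt0.
have T0' : 0 < T%:R :> R by rewrite ltr0n.
have M0 : 0 < (ncodewords (C x))%:R :> R by rewrite ltr0n (leq_trans _ (M1 x x0)).
have : `|r - rate (C x) / log2 x| <= w by near: x; exact: rr.
rewrite rate_ratioE ler_norml => /andP[_ h].
rewrite -ler_ln ?posrE ?powR_gt0// ln_powR.
have : (r - w) * ln x <= ln (ncodewords (C x))%:R / T%:R.
  by rewrite -ler_pdivlMr//; lra.
by rewrite ler_pdivlMr// => {}h; rewrite -mulrA mulrC.
Unshelve. all: by end_near. Qed.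

(** The choices are [a = x^(-(1-r)/2-w)] and [rho = x^(r-w)]. The signal energy is then [x^(r-2w)]
    up to smaller powers, hence negligible against [rho]. For [r = 0] the widening vanishes; for
    [w < r] the factor [(1 + rho)^T] is beaten by the number of codewords. *)
Lemma converse_core (v : R -> R) (ch : R -> @channel R d Omega n) (r w : R)
    T (C : R -> @code R n T) :
  two_product_channel P v ch -> 0 <= r <= 1 -> (0 < T)%N ->
  (forall x, 0 < x -> valid_code (C x)) ->
  doteq (fun x => average_power (C x)) 1%E ->
  multiplexing_gain C r ->
  0 < w -> r = 0 \/ w < r ->
  \forall x \near +oo,
    1 / 8 * ((expR (- 2^-1) * 2 / Num.sqrt (pi *+ 2)) ^+ 2 *
       x `^ (- ((1 - r) / 2) - w)) ^+ (n * 2) <=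
    error_probability P (ch x) (C x).
Proof.
move=> [v1 v0 chP] /andP[r0 r1] T0 valC powC gainC w0 rw.
(* Two factors [v x] and one factor of power lose [w / 6] each, [w / 2] in total, so the energy over
   [rho] is still of order [x^(-w/2)]. *)
have w6 : 0 < w / 6 by rewrite divr_gt0.
have w2 : 0 < w / 2 by rewrite divr_gt0.
have T0' : 0 < T%:R :> R by rewrite ltr0n.
have vb := doteq_bounds v1 w6; have pb := doteq_bounds powC w6.
have M1 x : 0 < x -> (1 < ncodewords (C x))%N by move=> /valC[].
have Mge := gain_ncodewords_ge T0 w2 M1 gainC.
pose K1 : R := 4 * n%:R ^+ 2 * (T * 2)%:R.
have K10 : 0 < K1 + 1 by rewrite ltr_wpDl// !mulr_ge0// sqr_ge0.
(* Half of [ln (5 / 4)] is allotted to the exponential factor and, when [r = 0], the other half to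
   [(1 + rho)^T]. *)
have l54 : 0 < ln (5 / 4) / 2 :> R by rewrite divr_gt0// ln_gt0//; lra.
have l54K : 0 < ln (5 / 4) / 2 / (K1 + 1) by rewrite divr_gt0.
have l54T : 0 < ln (5 / 4) / 2 / T%:R :> R by rewrite divr_gt0.
have Tw2 : 0 < T%:R * (w / 2) by rewrite mulr_gt0.
near=> x.
have x1 : 1 < x by near: x; exact: near_gt.
have x0 : 0 < x by rewrite (lt_trans ltr01).
have [gP hP nP ind] := chP _ x0.
have powRDx b c : x `^ b * x `^ c = x `^ (b + c).
  by rewrite powRD//; apply/implyP => _; rewrite gt_eqF.
have p0 b : 0 < x `^ b by exact: powR_gt0.
have vx : v x <= x `^ (w / 6).
  by have /andP[_] : x `^ (0 - w / 6) <= v x <= x `^ (0 + w / 6);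
    [near: x; exact: vb|rewrite add0r].
have /andP[plo phi] :
    x `^ (1 - w / 6) <= average_power (C x) <= x `^ (1 + w / 6).
  by near: x; exact: pb.
have Mx : x `^ (T%:R * (r - w / 2)) <= (ncodewords (C x))%:R.
  by near: x; exact: Mge.
have M2 : 2 <= (ncodewords (C x))%:R :> R by rewrite ler_nat; exact: M1.
have M0 : 0 < (ncodewords (C x))%:R :> R by rewrite (lt_le_trans _ M2).
set a := x `^ _; set M := (ncodewords (C x))%:R in Mx M2 M0 *.
set p := average_power (C x) in plo phi *.
have pp : 0 < p by rewrite (lt_le_trans _ plo).
have a01 : 0 <= a <= 1.
  rewrite powR_ge0 -(powRr0 x) ler_powR ?(ltW x1)//; lra.
pose rho := x `^ (r - w).
have rho0 : 0 < rho by exact: p0.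
have vx0 := v0 _ x0.
have := error_probability_ge vx0 gP hP nP ind (valC _ x0) pp a01 rho0.
apply: le_trans; rewrite ler_wpM2r//.
  by apply: exprn_ge0; apply: mulr_ge0; [exact: sqr_ge0|exact: powR_ge0].
rewrite -/M -/p.
set E := _ / rho.
have E0 : 0 <= E by rewrite divr_ge0 ?(ltW rho0)// mulr_ge0 ?sqr_ge0// mulr_ge0// ltW.
have Ele : E <= 4 * n%:R ^+ 2 * x `^ (- (w / 2)).
  rewrite ler_pdivrMr// -[leRHS]mulrA /rho powRDx.
  have -> : (n%:R * a * v x) ^+ 2 * (4 * p) = 4 * n%:R ^+ 2 * (a * a * (v x * v x * p)).
    by ring.
  rewrite ler_wpM2l// ?mulr_ge0 ?sqr_ge0//.
  have -> : x `^ (- (w / 2) + (r - w)) =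
      a * a * (x `^ (w / 6) * x `^ (w / 6) * x `^ (1 + w / 6)).
    by rewrite /a !powRDx; congr (x `^ _); field.
  rewrite ler_wpM2l ?mulr_ge0 ?powR_ge0//.
  have vv0 : 0 <= v x by exact: ltW.
  apply: ler_pM; [by rewrite mulr_ge0|exact: ltW| |exact: phi].
  exact: ler_pM.
have KE : (expR E * Num.sqrt (1 + rho)) ^+ (T * 2) =
    expR (E * (T * 2)%:R) * (1 + rho) ^+ T.
  rewrite exprMn -expRM_natr; congr (_ * _).
  by rewrite mulnC exprM sqr_sqrtr// addr_ge0// ltW.
have E54 : E * (T * 2)%:R <= ln (5 / 4) / 2.
  apply: (@le_trans _ _ (4 * n%:R ^+ 2 * (T * 2)%:R * x `^ (- (w / 2)))).
    by rewrite [leRHS]mulrAC ler_wpM2r.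
  have xK : x `^ (- (w / 2)) <= ln (5 / 4) / 2 / (K1 + 1).
    by near: x; apply: near_powRN_le => //.
  rewrite -/K1; apply: (@le_trans _ _ ((K1 + 1) * x `^ (- (w / 2)))).
    by rewrite ler_wpM2r ?powR_ge0// lerDl.
  by rewrite mulrC -ler_pdivlMr.
have expR54 : expR (ln (5 / 4)) = 5 / 4 :> R by rewrite lnK// posrE; lra.
have e54 : expR (E * (T * 2)%:R) <= expR (ln (5 / 4) / 2) by rewrite ler_expR.
(* The prefactor 1/8 is [3 / 4 - 5 / 8]. Since there are at least two codewords, a numerator of at
   most 5/4 is enough when [r = 0]. *)
suff : (expR E * Num.sqrt (1 + rho)) ^+ (T * 2) / M <= 5 / 8 by lra.
rewrite ler_pdivrMr// KE.
case: rw => [rz|wr].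
  have rhoT : rho * T%:R <= ln (5 / 4) / 2.
    have xT : x `^ (- w) <= ln (5 / 4) / 2 / T%:R.
      by near: x; exact: near_powRN_le.
    by rewrite -ler_pdivlMr// /rho rz sub0r.
  have rhoE : (1 + rho) ^+ T <= expR (ln (5 / 4) / 2).
    apply: (@le_trans _ _ (expR rho ^+ T)).
      by rewrite lerXn2r ?nnegrE ?expR_ge0 ?expR_ge1Dx// addr_ge0// ltW.
    by rewrite -expRM_natr ler_expR.
  apply: (@le_trans _ _ (5 / 4)); last by lra.
  apply: (le_trans (ler_pM _ _ e54 rhoE)); rewrite ?expR_ge0//.
    by rewrite exprn_ge0// addr_ge0// ltW.
  by rewrite -expRD -splitr expR54.
have rho1 : 1 <= rho by rewrite /rho -(powRr0 x) ler_powR ?(ltW x1)//; lra.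
have e54' : expR (E * (T * 2)%:R) <= 5 / 4.
  have : expR (ln (5 / 4) / 2) <= expR (ln (5 / 4)) :> R.
    by rewrite ler_expR; move: l54; lra.
  by rewrite expR54; exact: le_trans.
have rhoT : (1 + rho) ^+ T <= 2 ^+ T * x `^ (T%:R * (r - w)).
  rewrite [T%:R * _]mulrC powRrM powR_mulrn ?powR_ge0// -exprMn.
  by rewrite lerXn2r ?nnegrE ?addr_ge0 ?mulr_ge0 ?(ltW rho0)//; rewrite -/rho; lra.
have x2 : 2 ^+ T * 2 <= x `^ (T%:R * (w / 2)).
  by near: x; exact: near_powR_ge.
have {}Mx : x `^ (T%:R * (r - w)) * (2 ^+ T * 2) <= M.
  apply: le_trans Mx; apply: (@le_trans _ _ (x `^ (T%:R * (r - w)) * x `^ (T%:R * (w / 2)))).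
    by rewrite ler_wpM2l ?powR_ge0.
  by rewrite powRDx le_eqVlt; apply/orP; left; apply/eqP; congr (x `^ _); field.
apply: (le_trans (ler_pM _ _ e54' rhoT)); rewrite ?expR_ge0//.
  by rewrite exprn_ge0// addr_ge0// ltW.
lra.
Unshelve. all: by end_near. Qed.

Lemma error_probability_exponent_ge (v : R -> R) (ch : R -> @channel R d Omega n)
    (r : R) T (C : R -> @code R n T) :
  (0 < n)%N -> two_product_channel P v ch -> 0 <= r <= 1 -> (0 < T)%N ->
  (forall x, 0 < x -> valid_code (C x)) ->
  doteq (fun x => average_power (C x)) 1%E ->
  multiplexing_gain C r ->
  forall e, 0 < e ->
  \forall x \near +oo, x `^ (- (n%:R * (1 - r)) - e) <=
    error_probability P (ch x) (C x).
Proof.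
move=> n0 hch r01 T0 valC powC gainC e e0.
have n0' : 0 < n%:R :> R by rewrite ltr0n.
have [r0 r1] := andP r01.
(* The fade loses [2 * n * w <= e / 2] in the exponent, and the remaining [e / 2] absorbs the
   constants. The minimum with [r / 2] secures [w < r]. *)
have [w [w0 we rw]] : exists w, [/\ 0 < w, n%:R * (w *+ 4) <= e & r = 0 \/ w < r].
  have en : 0 < e / (n%:R *+ 4) by rewrite divr_gt0// pmulrn_lgt0.
  have ene : n%:R * ((e / (n%:R *+ 4)) *+ 4) <= e.
    by rewrite le_eqVlt; apply/orP; left; apply/eqP; field; rewrite gt_eqF.
  have [rz|rn] := eqVneq r 0; first by exists (e / (n%:R *+ 4)); split; [| |left].
  have r_gt0 : 0 < r by rewrite lt_neqAle eq_sym rn.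
  exists (Num.min (e / (n%:R *+ 4)) (r / 2)); split.
  - by rewrite lt_min en divr_gt0.
  - apply: le_trans ene; rewrite ler_wpM2l ?(ltW n0')// lerMn2r/=.
    by rewrite ge_min lexx.
  - by right; rewrite gt_min; apply/orP; right; lra.
have core := converse_core hch r01 T0 valC powC gainC w0 rw.
pose k : R := expR (- 2^-1) * 2 / Num.sqrt (pi *+ 2).
have k0 : 0 < k.
  by rewrite divr_gt0 ?mulr_gt0 ?expR_gt0// sqrtr_gt0 pmulrn_lgt0// pi_gt0.
have c0 : 0 < 1 / 8 * (k ^+ 2) ^+ (n * 2).
  by apply: mulr_gt0; [rewrite divr_gt0|do 2 apply: exprn_gt0].
have e2 : 0 < e / 2 by rewrite divr_gt0.
near=> x.
have x1 : 1 < x by near: x; exact: near_gt.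
have x0 : 0 < x by rewrite (lt_trans ltr01).
have h : 1 / 8 * (k ^+ 2 * x `^ (- ((1 - r) / 2) - w)) ^+ (n * 2) <=
    error_probability P (ch x) (C x) by near: x; exact: core.
apply: (le_trans _ h).
have xc : x `^ (- (e / 2)) <= 1 / 8 * (k ^+ 2) ^+ (n * 2).
  by near: x; exact: near_powRN_le.
rewrite exprMn mulrA -[X in _ <= _ * X]powR_mulrn ?powR_ge0// -powRrM.
apply: (@le_trans _ _ (x `^ (- (e / 2)) *
    x `^ ((- ((1 - r) / 2) - w) * (n * 2)%:R))); last by rewrite ler_wpM2r ?powR_ge0.
rewrite -powRD; last by apply/implyP => _; rewrite gt_eqF.
rewrite ler_powR ?(ltW x1)// natrM.
rewrite -subr_ge0 (_ : _ - _ = (e - n%:R * (w *+ 4)) / 2); last by field.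
by rewrite divr_ge0// subr_ge0.
Unshelve. all: by end_near. Qed.

End ConverseAsymptotics.

(** * Exponent of the diagonal code *)

Section Achievability.
Context {R : realType} {d : measure_display} {Omega : measurableType d}.
Context (P : probability Omega R) (n : nat).
Hypothesis n0 : (0 < n)%N.

(** A count rather than an exponent: the code has two more messages than this, hence at least two at
    every positive SNR. The factor [n] in the power is the block length. *)
Definition message_exponent (r x : R) : nat := Num.truncn (x `^ (n%:R * r)).

Lemma messages_bounds (r x : R) : 0 <= r -> 1 <= x ->
  x `^ (n%:R * r) <= (message_exponent r x).+2%:R <= 3 * x `^ (n%:R * r).
Proof.
move=> r0 x1; have p0 : 0 <= x `^ (n%:R * r) by rewrite powR_ge0.
have p1 : 1 <= x `^ (n%:R * r) by rewrite -[leLHS](powRr0 x) ler_powR ?mulr_ge0.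
have := truncn_itv p0; rewrite -/(message_exponent r x) -natr1 => /andP[h1 h2].
by rewrite -natr1 -natr1; apply/andP; split; lra.
Qed.

(** The logarithm of the number of messages is of order [ln x], so the loss is a power of [ln x]. *)
Lemma grid_loss_le (r e : R) : 0 <= r -> 0 < e -> \forall x \near +oo,
  grid_loss (n + n) (message_exponent r x).+2 <= x `^ e :> R.
Proof.
move=> r0 e0; set N := (n + n)%N.
have N0 : (0 < N)%N by rewrite addn_gt0 n0.
have N0' : 0 < N%:R :> R by rewrite ltr0n.
have eN0 : 0 < e / N%:R by rewrite divr_gt0.
pose g : R := (grid_const N)%:R.
have g1 : 1 <= g by rewrite /g ler1n /grid_const expn_gt0.
pose A := 4 + 8 * (ln g + ln 3); pose B := 8 * (n%:R * r).
near=> x.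
have xe : expR 1 <= x by near: x; exact: near_ge.
have x1 : 1 < x by near: x; exact: near_gt.
have x0 : 0 < x by rewrite (lt_trans ltr01).
have lx1 : 1 <= ln x by rewrite -[leLHS]expRK ler_ln ?posrE ?expR_gt0.
have ABx : (`|A| + B) * ln x <= x `^ (e / N%:R) by near: x; exact: near_ln_le.
have /andP[_ Mx] := messages_bounds r0 (ltW x1).
set M := (message_exponent r x).+2 in Mx *.
have M1 : 1 <= M%:R :> R by rewrite ler1n.
have p0 : 0 < x `^ (n%:R * r) by rewrite powR_gt0.
have M0 : 0 < M%:R :> R by [].
have g0 : 0 < g by rewrite (lt_le_trans ltr01).
have lM : ln M%:R <= ln 3 + n%:R * r * ln x.
  by rewrite -ln_powR -lnM ?posrE// ler_ln ?posrE// mulr_gt0.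
have gs : ln (grid_size N M)%:R = 2 * (ln g + ln M%:R) :> R.
  rewrite /grid_size natrX natrM lnXn ?mulr_gt0//.
  by rewrite lnM ?posrE// mulr_natl.
have -> : x `^ e = (x `^ (e / N%:R)) ^+ N.
  by rewrite -powR_mulrn ?powR_ge0// -powRrM divfK// gt_eqF.
rewrite /grid_loss lerXn2r ?nnegrE ?powR_ge0//.
  by rewrite gs mulr_ge0// addr_ge0// mulr_ge0// addr_ge0// ln_ge0.
apply: le_trans ABx; rewrite gs.
have hA : A <= `|A| * ln x.
  by rewrite (le_trans (ler_norm _))// ler_peMr.
rewrite [leRHS]mulrDl; apply: (@le_trans _ _ (A + B * ln x)); last by rewrite lerD2r.
by rewrite /A /B; lra.
Unshelve. all: by end_near. Qed.

Section CodeFamily.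
Variable pts : forall q, 'I_q.+2 -> 'I_(n + n) -> R.
Hypothesis pts12 : forall q (m : 'I_q.+2) t, 1 <= pts m t <= 2.
Hypothesis pts_dist : forall q (m m' : 'I_q.+2), m != m' ->
  (q.+2%:R * grid_loss (n + n) q.+2)^-1 <= \prod_t `|pts m t - pts m' t|.

Definition snr_code (r x : R) : @code R n n :=
  nearest_code (@pts (message_exponent r x)) x.

Lemma kappa_gt0 q : 0 < q.+2%:R * grid_loss (n + n) q.+2 :> R.
Proof. by rewrite mulr_gt0// grid_loss_gt0. Qed.

Lemma snr_code_valid r x : valid_code (snr_code r x).
Proof.
apply: nearest_code_valid => // m m' mm'.
exact: (xdist_gt0 (kappa_gt0 (message_exponent r x)) (@pts_dist (message_exponent r x)) mm').
Qed.

Lemma snr_code_power r : doteq (fun x => average_power (snr_code r x)) 1%E.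
Proof.
apply: doteqP => e e0; near=> x.
have x1 : 1 < x by near: x; exact: near_gt.
have x0 : 0 < x by rewrite (lt_trans ltr01).
have /andP[h1 h2] := nearest_code_power (@pts12 (message_exponent r x)) x0.
have n8 : n%:R * 8 <= x `^ e by near: x; exact: near_powR_ge.
have xNe : x `^ (- e) <= 1 by rewrite -(powRr0 x) ler_powR ?(ltW x1)//; lra.
have n1 : 1 <= n%:R :> R by rewrite ler1n.
have xD b : x `^ (1 + b) = x * x `^ b.
  rewrite powRD ?powRr1 ?(ltW x0)//.
  by apply/implyP => _; rewrite gt_eqF.
rewrite !xD; apply/andP; split.
  by apply: le_trans h1; rewrite -mulrA ler_wpM2l ?(ltW x0)//; lra.
by apply: (le_trans h2); rewrite -mulrA ler_wpM2l ?(ltW x0).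
Unshelve. all: by end_near. Qed.

Lemma snr_code_gain r : 0 <= r -> multiplexing_gain (snr_code r) r.
Proof.
move=> r0; have n0' : 0 < n%:R :> R by rewrite ltr0n.
apply/cvgrPdist_le => e e0; near=> x.
have x1 : 1 < x by near: x; exact: near_gt.
have x0 : 0 < x by rewrite (lt_trans ltr01).
have lx : 0 < ln x by rewrite ln_gt0.
have xl : ln 3 / (n%:R * e) <= ln x.
  rewrite -[leLHS]expRK ler_ln ?posrE ?expR_gt0//; near: x; exact: near_ge.
rewrite rate_ratioE /=.
have /andP[] := messages_bounds r0 (ltW x1).
set M := (message_exponent r x).+2 => h1 h2.
have M0 : 0 < M%:R :> R by [].
have p0 : 0 < x `^ (n%:R * r) by rewrite powR_gt0.
have l1 : n%:R * r * ln x <= ln M%:R by rewrite -ln_powR ler_ln.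
have l2 : ln M%:R <= ln 3 + n%:R * r * ln x.
  by rewrite -ln_powR -lnM ?posrE// ler_ln ?posrE// mulr_gt0.
have l3 : ln 3 <= ln x * (n%:R * e) by rewrite -ler_pdivrMr ?mulr_gt0.
have q1 : r <= ln M%:R / n%:R / ln x.
  by rewrite -mulrA -invfM ler_pdivlMr ?mulr_gt0//; lra.
have q2 : ln M%:R / n%:R / ln x <= r + e.
  by rewrite -mulrA -invfM ler_pdivrMr ?mulr_gt0//; lra.
by rewrite ler_norml; apply/andP; split; lra.
Unshelve. all: by end_near. Qed.

Lemma snr_code_error (v : R -> R) (ch : R -> @channel R d Omega n) r e :
  two_product_channel P v ch -> 0 <= r <= 1 -> 0 < e ->
  \forall x \near +oo, error_probability P (ch x) (snr_code r x) <=
    x `^ (- (n%:R * (1 - r)) + e).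
Proof.
move=> [v1 v0 chP] /andP[r0 r1] e0.
have n0' : 0 < n%:R :> R by rewrite ltr0n.
(* The budget in units of [eta]: [n + 2] for [delta], [2n + 2] for the fading probability, and 1 for
   adding the fading and noise terms. *)
pose eta := e / (n%:R *+ 3 + 5).
have den0 : 0 < n%:R *+ 3 + 5 :> R by rewrite addr_gt0// pmulrn_lgt0.
have eta0 : 0 < eta by rewrite divr_gt0.
have eE : e = (n%:R *+ 3 + 5) * eta by rewrite /eta mulrC divfK// gt_eqF.
pose D := n%:R * (1 - r) - (n%:R + 2) * eta.
(* If [D <= 0] the target exponent is nonnegative, and the trivial bound 1 on the error probability
   is enough. *)
have [D0|D0] := leP D 0.
  near=> x.
  have x1 : 1 < x by near: x; exact: near_gt.
  have x0 : 0 < x by rewrite (lt_trans ltr01).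
  have [gP hP nP _] := chP _ x0.
  apply: (@le_trans _ _ 1).
    apply: error_probability_le1; last exact: snr_code_valid.
    by move=> k; exact: (channel_rv_cmeasurable gP hP nP).
  rewrite -[leLHS](powRr0 x) ler_powR ?(ltW x1)//.
  have : 0 <= n%:R * eta by rewrite mulr_ge0// ltW.
  by move: D0; rewrite /D eE; lra.
pose K := (Num.truncn (n%:R * (n%:R *+ 2) / eta + n%:R *+ 2)).+1.
have K0 : 0 < K%:R :> R by [].
have KE : n%:R * (n%:R *+ 2) / eta + n%:R *+ 2 <= K%:R :> R.
  by rewrite ltW// truncnS_gt.
have nK1 : (n + n)%:R / K%:R <= 1 :> R.
  rewrite ler_pdivrMr// mul1r; apply: le_trans KE.
  rewrite natrD -mulr2n lerDr divr_ge0 ?(ltW eta0)// mulr_ge0// mulrn_wge0//.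
have nKeta : n%:R * ((n + n)%:R / K%:R) <= eta :> R.
  rewrite mulrA ler_pdivrMr// -ler_pdivrMl//; apply: le_trans KE.
  by rewrite natrD -mulr2n mulrC lerDl mulrn_wge0.
pose c1 : R := K.+1%:R ^+ (n + n) * 2 ^+ (n + n).
pose c2 : R := (n * 2)%:R * Num.sqrt 2.
pose c3 : R := 3 * (8 * n%:R) ^+ n.
near=> x.
have x1 : 1 < x by near: x; exact: near_gt.
have x0 : 0 < x by rewrite (lt_trans ltr01).
have [gP hP nP ind] := chP _ x0.
have powRDx b c : x `^ b * x `^ c = x `^ (b + c).
  by rewrite powRD//; apply/implyP => _; rewrite gt_eqF.
have p0 b : 0 < x `^ b by exact: powR_gt0.
have powX b (k : nat) : (x `^ b) ^+ k = x `^ (b * k%:R).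
  by rewrite -powR_mulrn ?powR_ge0// -powRrM.
have pmono b c : b <= c -> x `^ b <= x `^ c by apply: ler_powR; exact: ltW.
have vx0 := v0 _ x0.
have vlo : x `^ (- eta) <= v x.
  have : x `^ (0 - eta) <= v x <= x `^ (0 + eta) by near: x; exact: doteq_bounds.
  by rewrite sub0r => /andP[].
have gl : grid_loss (n + n) (message_exponent r x).+2 <= x `^ eta.
  by near: x; exact: grid_loss_le.
have c1x : c1 <= x `^ eta by near: x; exact: near_powR_ge.
have c2x : c2 <= x by near: x; exact: near_ge.
have c3x : c3 <= x `^ eta by near: x; exact: near_powR_ge.
have x2 : 2 <= x `^ eta by near: x; exact: near_powR_ge.
have lnx : (2 * (n%:R + 1)) * ln x <= x `^ eta by near: x; exact: near_ln_le.
have /andP[_ Mx] := messages_bounds r0 (ltW x1).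
pose kappa : R := (message_exponent r x).+2%:R * grid_loss (n + n) (message_exponent r x).+2.
have kappa0 : 0 < kappa by exact: kappa_gt0.
have kappax : kappa <= 3 * x `^ (n%:R * r + eta).
  rewrite -powRDx mulrA; apply: ler_pM => //.
  by apply: ltW; exact: grid_loss_gt0.
(* A noise radius growing like a small power makes the tail [expR (- a ^+ 2 / 2)] smaller than any
   fixed power of [x], at the price of [n * eta] in [delta]. *)
pose a := x `^ (eta / 2).
have a0 : 0 < a by exact: p0.
have a2 : a ^+ 2 = x `^ eta by rewrite powX divfK.
have deltaE : (8 * n%:R * a ^+ 2 / x) ^+ n * kappa <= x `^ (- D).
  rewrite a2 -mulrA -[x in _ / x]powRr1 ?(ltW x0)// -powRN powRDx exprMn powX.
  apply: (@le_trans _ _ ((8 * n%:R) ^+ n * x `^ ((eta - 1) * n%:R) *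
      (3 * x `^ (n%:R * r + eta)))).
    by rewrite ler_wpM2l// mulr_ge0 ?powR_ge0// exprn_ge0// mulr_ge0.
  rewrite (_ : _ * _ = c3 * (x `^ ((eta - 1) * n%:R) * x `^ (n%:R * r + eta)));
    last by rewrite /c3; ring.
  apply: (@le_trans _ _ (x `^ eta * (x `^ ((eta - 1) * n%:R) * x `^ (n%:R * r + eta)))).
    by rewrite ler_wpM2r// mulr_ge0// ltW.
  by rewrite !powRDx; apply: pmono; rewrite /D; lra.
have delta1 : (8 * n%:R * a ^+ 2 / x) ^+ n * kappa <= 1.
  apply: (le_trans deltaE); rewrite -[leRHS](powRr0 x); apply: pmono.
  by rewrite oppr_le0 ltW.
have delta0 : 0 <= (8 * n%:R * a ^+ 2 / x) ^+ n * kappa.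
  by rewrite mulr_ge0 ?(ltW kappa0)// exprn_ge0// divr_ge0 ?(ltW x0)// !mulr_ge0// ltW.
have Cx : Num.max 1 (4 / (pi * v x)) <= 2 * x `^ eta.
  rewrite ge_max; apply/andP; split; first by lra.
  rewrite ler_pdivrMr ?mulr_gt0 ?pi_gt0//.
  have : 1 <= x `^ eta * v x.
    apply: (@le_trans _ _ (x `^ eta * x `^ (- eta))); last by rewrite ler_wpM2l// ltW.
    by rewrite powRDx subrr powRr0.
  have := pi_ge2 R; nra.
apply: (le_trans (nearest_error_probability_le (ch := ch x) (K := K) x0 kappa0
  (@pts_dist _) n0 vx0 gP hP nP ind a0 _ delta1)) => //.
have T1 : K.+1%:R ^+ (n + n) * Num.max 1 (4 / (pi * v x)) ^+ (n + n) *
    ((8 * n%:R * a ^+ 2 / x) ^+ n * kappa) `^ (1 - (n + n)%:R / K%:R) <=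
    x `^ (- D + (n%:R *+ 2 + 2) * eta).
  apply: (@le_trans _ _ (K.+1%:R ^+ (n + n) * (2 * x `^ eta) ^+ (n + n) *
      (x `^ (- D)) `^ (1 - (n + n)%:R / K%:R))).
    apply: ler_pM; rewrite ?powR_ge0//.
    - by rewrite mulr_ge0 ?exprn_ge0// le_max ler01.
    - rewrite ler_wpM2l ?exprn_ge0// lerXn2r ?nnegrE//.
        by rewrite le_max ler01.
      by rewrite mulr_ge0// ltW.
    - by apply: ge0_ler_powR; rewrite ?nnegrE ?subr_ge0 ?powR_ge0.
  rewrite exprMn mulrA -/c1 -powRrM powX -mulrA powRDx.
  apply: (@le_trans _ _ (x `^ eta *
     x `^ (eta * (n + n)%:R + - D * (1 - (n + n)%:R / K%:R)))).
    by rewrite ler_wpM2r ?powR_ge0.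
  rewrite powRDx; apply: pmono.
  have Dn : D * ((n + n)%:R / K%:R) <= eta.
    apply: le_trans nKeta; rewrite ler_wpM2r ?divr_ge0//.
    have : 0 <= n%:R * eta by rewrite mulr_ge0// ltW.
    have : 0 <= n%:R * r by rewrite mulr_ge0.
    by rewrite /D; lra.
  rewrite natrD; move: Dn; rewrite natrD; lra.
have T2 : (n * 2)%:R * (expR (- a ^+ 2 / 2) * Num.sqrt 2) <=
    x `^ (- D + (n%:R *+ 2 + 2) * eta).
  rewrite mulrCA mulrC -/c2.
  have ex : expR (- a ^+ 2 / 2) <= x `^ (- (n%:R + 1)).
    by rewrite a2 [leRHS]/powR gt_eqF// ler_expR; lra.
  apply: (@le_trans _ _ (x `^ 1 * x `^ (- (n%:R + 1)))).
    by rewrite powRr1 ?(ltW x0)//; apply: ler_pM; rewrite ?expR_ge0// /c2 mulr_ge0 ?sqrtr_ge0.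
  rewrite powRDx; apply: pmono.
  have : 0 <= n%:R * eta by rewrite mulr_ge0// ltW.
  have : 0 <= n%:R * r by rewrite mulr_ge0.
  by rewrite /D; lra.
apply: (le_trans (lerD T1 T2)); set Y := x `^ (- D + _).
have Y0 : 0 <= Y by exact: powR_ge0.
apply: (@le_trans _ _ (x `^ eta * Y)); first by nra.
by rewrite powRDx; apply: pmono; rewrite /D eE; lra.
Unshelve. all: by end_near. Qed.

End CodeFamily.
End Achievability.

Theorem proposition1 (R : realType) (d : measure_display)
    (Omega : measurableType d) (P : probability Omega R)
    (n : nat) (hn : (0 < n)%N)
    (v : R -> R) (ch : R -> @channel R d Omega n)
    (hch : two_product_channel P v ch)
    (r : R) (hr0 : 0 <= r) (hr1 : r <= 1) :
  optimal_tradeoff P ch r (n%:R * (1 - r))%:E.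
Proof.
have r01 : 0 <= r <= 1 by rewrite hr0.
split.
  have nn0 : (0 < n + n)%N by rewrite addn_gt0 hn.
  have pts_ex q := @product_distance_code R (n + n) q.+2 nn0 isT.
  (* A point set is chosen for every size at once, so that the code becomes a function of the
     SNR. *)
  pose pts q := projT1 (cid (pts_ex q)).
  have pts12 q m t : 1 <= pts q m t <= 2.
    by rewrite /pts; case: cid => x [] /=.
  have pts_dist q (m m' : 'I_q.+2) : m != m' ->
      (q.+2%:R * grid_loss (n + n) q.+2)^-1 <= \prod_t `|pts q m t - pts q m' t|.
    by rewrite /pts; case: cid => x [_] /=; apply.
  have valC x : 0 < x -> valid_code (snr_code pts r x).
    by move=> _; exact: snr_code_valid.
  have powC := snr_code_power hn pts12 r.
  have gainC := snr_code_gain hn pts hr0.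
  exists n, (snr_code pts r); split => //.
  rewrite /diversity_gain -EFinN; apply: doteqP => e e0.
  have lower := error_probability_exponent_ge hn hch r01 hn valC powC gainC e0.
  have upper := snr_code_error hn pts_dist hch r01 e0.
  by near=> x; apply/andP; split; near: x.
move=> l [T [C [T0 valC powC gainC divC]]].
(* Diversity is minus the exponent of the error, so the lower bound on the error, valid for every
   duration [T], becomes an upper bound on [l]. *)
rewrite -leeN2 -EFinN; apply: doteq_ge divC _ => e e0.
exact: (error_probability_exponent_ge hn hch r01 T0 valC powC gainC e0).
Unshelve. all: by end_near. Qed.
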